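(* There is an algorithm that, given an instance $((G,\tau),S,k,h)$ of $\mathrm{MinReachDelete}$ where $(G,\tau)$ has lifetime $\Lambda$, decides whether it is a yes-instance in time $\mathcal{O}(w^2 h 2^{w^2}\Lambda)$, where $w=\mathrm{vimw}(G,\tau)$.
   Context: A temporal graph is a pair $(G,\tau)$ where $G$ is a finite simple graph and $\tau: E(G)\to 2^{\mathbb{N}}$ assigns to each edge $e$ a finite set $\tau(e)$ of times at which $e$ is active; $(e,t)$ with $t\in\tau(e)$ is a time-edge. The lifetime is $\Lambda=\max_e\max\tau(e)$. A (strict) temporal walk is a sequence of time-edges $(e_1,t_1),\dots,(e_n,t_n)$ with $e_1,\dots,e_n$ a walk in $G$ and $t_1<\dots<t_n$; a temporal path from $v$ to $u$ is such a walk from $v$ to $u$ visiting no vertex twice. A vertex $u$ is temporally reachable from $v$ if there is a temporal path from $v$ to $u$ (every vertex is reachable from itself). For $S\subseteq V(G)$, $\mathrm{reach}_{G,\tau}(S)$ is the set of vertices temporally reachable from some vertex of $S$, and its size is the temporal reachability of $S$. For a set $E'$ of time-edges, $(G,\tau)\setminus E'$ is obtained by removing $t$ from $\tau(e)$ for each $(e,t)\in E'$. $\mathrm{MinReachDelete}$: given $(G,\tau)$, $S\subseteq V(G)$ and $k,h\in\mathbb{N}$, decide whether there is a set $E'$ of time-edges with $|E'|\le k$ such that the temporal reachability of $S$ in $(G,\tau)\setminus E'$ is at most $h$. The vertex-interval-membership-width is $\mathrm{vimw}(G,\tau)=\max_{t\in[\Lambda]}|F_t|$ where $F_t=\{v\in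 V(G): \exists\, i\le t\le j \text{ and } u,w\in V(G) \text{ (not necessarily distinct) with } i\in\tau(uv),\ j\in\tau(wv)\}$. *)

(* Defs.v *)
From HB Require Import structures.
From mathcomp Require Import all_boot finmap.
From mathcomp Require Import boolp.

Set Implicit Arguments.
Unset Strict Implicit.
Unset Printing Implicit Defensive.

Local Open Scope fset_scope.

(* An edge uv is the two-element set [set u; v].  [tau] is a total function,
   empty outside the edge set.  Times are positive: they range over [Lambda],
   which starts at 1. *)
Record tgraph (V : finType) := TGraph {
  edges : {set {set V}};
  tau : {set V} -> {fset nat};
  edges_card2 : forall e, e \in edges -> #|e| = 2;
  tau_edges : forall e, e \notin edges -> tau e = fset0;
  tau_pos : forall e, 0 \notin tau e
}.

Section TemporalGraph.
Variable V : finType.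
Implicit Types (G : tgraph V) (u v w : V) (e : {set V}) (t : nat).

Definition time_edges G : seq ({set V} * nat) :=
  [seq (e, t) | e <- enum (edges G), t <- tau G e].

Definition lifetime G : nat := \max_(e in edges G) \max_(t <- tau G e) t.

(* The step (x, t) of a walk standing at v is the time-edge ([set v; x], t). *)
Fixpoint is_walk G v (p : seq (V * nat)) : bool :=
  if p is (x, t) :: p' then
    (([set v; x], t) \in time_edges G) && is_walk G x p'
  else true.

Definition temporal_walk G v u (p : seq (V * nat)) : bool :=
  [&& is_walk G v p, sorted ltn (unzip2 p) & last v (unzip1 p) == u].

Definition temporal_path G v u (p : seq (V * nat)) : bool :=
  temporal_walk G v u p && uniq (v :: unzip1 p).

Definition reachable G v u : Prop := exists p, temporal_path G v u p.

Definition reach G (S : {set V}) : {set V} :=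
  [set u | `[< exists2 v, v \in S & reachable G v u >]].

Section Delete.
Variables (G : tgraph V) (D : {fset {set V} * nat}).

Definition del_tau e : {fset nat} := [fset t in tau G e | (e, t) \notin D].

Lemma del_tau_edges e : e \notin edges G -> del_tau e = fset0.
Proof.
by move=> eG; apply/fsetP => t; rewrite !inE /= (tau_edges eG) inE.
Qed.

Lemma del_tau_pos e : 0 \notin del_tau e.
Proof. by rewrite !inE /= negb_and tau_pos. Qed.

Definition delete : tgraph V :=
  TGraph (@edges_card2 V G) del_tau_edges del_tau_pos.

End Delete.

Definition MinReachDelete G (S : {set V}) (k h : nat) : Prop :=
  exists D : {fset {set V} * nat},
    [/\ {subset D <= time_edges G}, #|` D| <= k & #|reach (delete G D) S| <= h].

Definition vim_set G t : {set V} :=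
  [set v | `[< exists i j u w,
    [/\ i <= t, t <= j, i \in tau G [set u; v] & j \in tau G [set w; v]] >]].

Definition vimw G : nat := \max_(1 <= t < (lifetime G).+1) #|vim_set G t|.

End TemporalGraph.

(* Model of computation: a random access machine with natural-number cells,
   finitely many scalar variables and finitely many unbounded arrays per
   program, programmed in structured form.  Each operation (constant, variable
   access, addition, truncated subtraction, array read, assignment, array
   write, test) costs one time unit.  Multiplication, division and bit
   operations are not primitive, so the uniform cost measure is the usual
   reasonable one. *)
Inductive expr :=
  | Cst of nat
  | Var of nat
  | Add of expr & expr
  | Sub of expr & expr
  | Read of nat & expr.

Inductive cmd :=
  | Skip
  | Assign of nat & expr
  | Write of nat & expr & expr
  | Seq of cmd & cmd
  | If of expr & cmd & cmd
  | While of expr & cmd.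

Record state := State { vars : nat -> nat; arrs : nat -> nat -> nat }.

Definition upd (T : Type) (f : nat -> T) (x : nat) (a : T) : nat -> T :=
  fun y => if y == x then a else f y.

Fixpoint eval (s : state) (e : expr) : nat :=
  match e with
  | Cst c => c
  | Var x => vars s x
  | Add e1 e2 => eval s e1 + eval s e2
  | Sub e1 e2 => eval s e1 - eval s e2
  | Read a i => arrs s a (eval s i)
  end.

Fixpoint ecost (e : expr) : nat :=
  match e with
  | Cst _ | Var _ => 1
  | Add e1 e2 | Sub e1 e2 => (ecost e1 + ecost e2).+1
  | Read _ i => (ecost i).+1
  end.

(* [exec c s T s']: started in state s, the program c halts in state s' after
   exactly T time units.  A test succeeds when its value is nonzero. *)
Inductive exec : cmd -> state -> nat -> state -> Prop :=
  | ExecSkip s : exec Skip s 1 s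
  | ExecAssign x e s :
      exec (Assign x e) s (ecost e).+1
           (State (upd (vars s) x (eval s e)) (arrs s))
  | ExecWrite a i e s :
      exec (Write a i e) s (ecost i + ecost e).+1
           (State (vars s)
                  (upd (arrs s) a (upd (arrs s a) (eval s i) (eval s e))))
  | ExecSeq c1 c2 s1 s2 s3 T1 T2 :
      exec c1 s1 T1 s2 -> exec c2 s2 T2 s3 -> exec (Seq c1 c2) s1 (T1 + T2) s3
  | ExecIfTrue e c1 c2 s s' T :
      eval s e != 0 -> exec c1 s T s' -> exec (If e c1 c2) s (ecost e + T).+1 s'
  | ExecIfFalse e c1 c2 s s' T :
      eval s e == 0 -> exec c2 s T s' -> exec (If e c1 c2) s (ecost e + T).+1 s'
  | ExecWhileTrue e c s1 s2 s3 T1 T2 :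
      eval s1 e != 0 -> exec c s1 T1 s2 -> exec (While e c) s2 T2 s3 ->
      exec (While e c) s1 (ecost e + T1 + T2).+1 s3
  | ExecWhileFalse e c s :
      eval s e == 0 -> exec (While e c) s (ecost e).+1 s.

Lemma exec_det c s T1 s1 T2 s2 :
  exec c s T1 s1 -> exec c s T2 s2 -> T1 = T2 /\ s1 = s2.
Proof.
move=> ex1; elim: ex1 T2 s2 => {c s T1 s1}.
- by move=> s T2 s2 ex2; inversion ex2.
- by move=> x e s T2 s2 ex2; inversion ex2.
- by move=> a i e s T2 s2 ex2; inversion ex2.
- move=> c1 c2 s1 s2 s3 T1 T2 _ IH1 _ IH2 T s ex2.
  inversion ex2 as [| | |? ? ? ? ? ? ? x1 x2| | | |]; subst.
  by have [? ?] := IH1 _ _ x1; subst; have [? ?] := IH2 _ _ x2; subst.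
- move=> e c1 c2 s s' T et _ IH T2 s2 ex2.
  inversion ex2 as [| | | |? ? ? ? ? ? b x|? ? ? ? ? ? b x| |]; subst.
    by have [? ?] := IH _ _ x; subst.
  by rewrite b in et.
- move=> e c1 c2 s s' T et _ IH T2 s2 ex2.
  inversion ex2 as [| | | |? ? ? ? ? ? b x|? ? ? ? ? ? b x| |]; subst.
    by rewrite et in b.
  by have [? ?] := IH _ _ x; subst.
- move=> e c s1 s2 s3 T1 T2 et _ IH1 _ IH2 T s ex2.
  inversion ex2 as [| | | | | |? ? ? ? ? ? ? b x1 x2|? ? ? b]; subst.
    by have [? ?] := IH1 _ _ x1; subst; have [? ?] := IH2 _ _ x2; subst.
  by rewrite b in et.
- move=> e c s et T2 s2 ex2.
  inversion ex2 as [| | | | | |? ? ? ? ? ? ? b x1 x2|? ? ? b]; subst => //.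
  by rewrite et in b.
Qed.

(* The input is the list of vertices of S, the list of edges of G and the list
   of time-edges, each without repetition but in arbitrary order and with
   arbitrary orientation of the edges, together with n, k, h and the lengths of
   the three lists.  All remaining cells are initially zero. *)
Definition input_state (n k h : nat) (ss : seq 'I_n) (es : seq ('I_n * 'I_n))
    (ts : seq ('I_n * 'I_n * nat)) : state :=
  State
    (nth 0 [:: n; k; h; size ss; size es; size ts])
    (fun a => nth 0 (nth [::]
      [:: [seq val x | x <- ss];
          [seq val x.1 | x <- es]; [seq val x.2 | x <- es];
          [seq val x.1.1 | x <- ts]; [seq val x.1.2 | x <- ts];
          [seq x.2 | x <- ts]] a)).

Definition encodes (n : nat) (G : tgraph 'I_n) (S : {set 'I_n}) (k h : nat)
    (s : state) : Prop :=
  exists ss es ts,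
    [/\ perm_eq ss (enum S),
        perm_eq [seq [set x.1; x.2]%SET | x <- es] (enum (edges G)),
        perm_eq [seq ([set x.1.1; x.1.2]%SET, x.2) | x <- ts] (time_edges G)
      & s = input_state k h ss es ts].

Definition accepts (s : state) : bool := vars s 0 != 0.

(* Main.v *)
Require Import Defs.
From mathcomp Require Import all_boot.
From mathcomp Require Import finmap boolp zify.
From Stdlib Require Import FunctionalExtensionality.

(** An instance is positive iff there is an assignment of infection times
    [f : V -> nat], zero on the sources and never (larger than the lifetime)
    for all but at most [h] vertices, such that at most [k] time-edges [(uv, t)]
    satisfy [f u < t < f v] or [f v < t < f u]: those are the time-edges that
    must be deleted, and earliest arrival times give such an [f].  Moreover [f v]
    may be restricted to the times at which [v] lies in the set [F_t].

    The optimal [f] is found by dynamic programming over time.  The table for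
    time [t] is indexed by the infected subset of the vertices of [F_t] that are
    still active after [t] and by the number [r <= h] of infected vertices; it
    stores the best remaining budget [k + 1 - cost], with [0] for infeasible.  A
    step enumerates the [3 ^ #|F_t|] ways to place the vertices of [F_t] before,
    at, or after [t], and [3 ^ w <= 2 ^ (w ^ 2)] as soon as a time-edge exists. *)

Set Implicit Arguments.
Unset Strict Implicit.
Unset Printing Implicit Defensive.

(** * Base 3 codes *)

(** The bound has no term in the number of vertices, so no loop may run over all of them: a vertex
    is met only through the source list and the time-edges, and the rest relies on cells being
    initially zero. Three positions per vertex suffice because walks are strict: a time-edge at [t]
    must be deleted exactly when one end is infected before [t] and the other not by [t], while an
    end infected at [t] itself neither transmits at [t] nor needs protection. Decoding a placement
    costs O(w), charging it costs one unit per simultaneous time-edge, of which there are at most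
    [w ^ 2], and updating the counts costs O(h); this is the origin of the factor [w ^ 2 * h].
    Storing the remaining budget instead of the cost turns minima into maxima, which truncated
    subtraction computes, and lets an untouched cell mean infeasible. As multiplication is not
    primitive, codes are sums of precomputed weights. *)

Fixpoint base3 (l : seq nat) (d : nat -> nat) : nat :=
  if l is u :: l' then d u + 3 * base3 l' d else 0.

Definition digit (l : seq nat) (q u : nat) : nat := (q %/ 3 ^ index u l) %% 3.

(* The unit is [h.+1], which leaves room for a count [r <= h] below every code. *)
Definition weight (h : nat) (l : seq nat) (u : nat) : nat :=
  if u \in l then h.+1 * 3 ^ index u l else 0.

Lemma digit_lt3 l q u : digit l q u < 3.
Proof. by rewrite ltn_mod. Qed.

Lemma base3_lt l d : (forall u, d u < 3) -> base3 l d < 3 ^ size l.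
Proof.
move=> dlt; elim: l => //= u l IHl.
by have := dlt u; rewrite expnS; lia.
Qed.

Lemma eq_base3 l d d' : {in l, d =1 d'} -> base3 l d = base3 l d'.
Proof.
elim: l => //= u l IHl dd'; rewrite dd' ?mem_head // IHl // => v vl.
by rewrite dd' // inE vl orbT.
Qed.

Lemma base3_inj l d d' :
  (forall u, d u < 3) -> (forall u, d' u < 3) ->
  base3 l d = base3 l d' -> {in l, d =1 d'}.
Proof.
move=> dlt dlt'; elim: l => //= u l IHl eqd v.
have := dlt u; have := dlt' u; rewrite inE => du' du /predU1P[->|]; first by lia.
by apply: IHl; lia.
Qed.

(** Every placement agrees on [l] with the digits of some [q < 3 ^ size l], so a counter running up
    to that bound enumerates them all. *)
Lemma digit_base3 l d : uniq l -> (forall u, d u < 3) ->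
  {in l, digit l (base3 l d) =1 d}.
Proof.
rewrite /digit => + dlt; elim: l => //= u l IHl /andP[ul Ul] v.
have du := dlt u.
rewrite inE => /predU1P[->|vl]; first by rewrite eqxx expn0 divn1; lia.
rewrite ifN; last by apply: contraNneq ul => ->.
rewrite expnS divnMA (_ : _ %/ 3 = base3 l d); last by lia.
exact: IHl.
Qed.

(** The program adds weights along the whole bag [B]; vertices outside [K] weigh [0], so the sum is
    the scaled code of a subset of [K]. *)
Lemma sum_weight h K B (p : pred nat) : uniq K -> uniq B -> {subset K <= B} ->
  \sum_(u <- B | p u) weight h K u = h.+1 * base3 K p.
Proof.
move=> UK UB sKB.
transitivity (\sum_(u <- K | p u) weight h K u).
  rewrite -[RHS]big_filter -[LHS]big_filter.
  rewrite (bigID (mem K)) /= [X in _ + X]big1 ?addn0; last first.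
    by move=> u; rewrite /weight => /negPf ->.
  rewrite -big_filter; apply: perm_big; apply: uniq_perm.
  - by rewrite !filter_uniq.
  - by rewrite filter_uniq.
  move=> u; rewrite !mem_filter; case: (boolP (u \in K)) => /= uK.
    by rewrite (sKB _ uK).
  by rewrite andbF.
elim: K UK {B UB sKB} => [|u K IHK] /=; first by rewrite big_nil muln0.
case/andP=> uK UK; rewrite big_cons mulnDr mulnCA -IHK // big_distrr /=.
have -> : weight h (u :: K) u = h.+1 by rewrite /weight mem_head /= eqxx muln1.
have -> : \sum_(i <- K | p i) weight h (u :: K) i
          = \sum_(i <- K | p i) 3 * weight h K i.
  rewrite big_seq_cond [RHS]big_seq_cond; apply: eq_bigr => v /andP[vK _].
  rewrite /weight inE vK orbT /=.
  by rewrite ifN; [rewrite expnS mulnCA | apply: contraNneq uK => ->].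
by case: (p u); rewrite ?muln1 ?muln0.
Qed.

Lemma sum_weight_lt h K B (p : pred nat) r :
  uniq K -> uniq B -> {subset K <= B} -> r <= h ->
  \sum_(u <- B | p u) weight h K u + r < h.+1 * 3 ^ size K.
Proof.
move=> UK UB sKB rh; rewrite sum_weight //.
have : base3 K p < 3 ^ size K by apply: base3_lt => u; case: (p u).
by nia.
Qed.

(** * Infection times and the table *)

Definition ends (x : nat * nat * nat) : seq nat := [:: x.1.1; x.1.2].

(* 2: infected before time t, 1: infected at time t, 0: not yet infected. *)
Definition phase (t : nat) (f : nat -> nat) (u : nat) : nat :=
  (f u <= t) + (f u < t).

(* Equals 1 if the phases of the endpoints are 0 and 2, and 0 otherwise. *)
Definition viol (d : nat -> nat) (x : nat * nat * nat) : nat :=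
  (d x.1.1 - d x.1.2 - 1) + (d x.1.2 - d x.1.1 - 1).

Section Dynamic.
Variables (k h : nat) (ss : seq nat) (ts : seq (nat * nat * nat)).
Hypothesis ts_pos : forall x, x \in ts -> 0 < x.2.

Definition verts : seq nat := undup (flatten (map ends ts)).
Definition seen (t u : nat) : bool := has (fun x => (x.2 <= t) && (u \in ends x)) ts.
Definition last_time (u : nat) : nat := \max_(x <- ts | u \in ends x) x.2.
Definition max_time : nat := \max_(x <- ts) x.2.

(* Infection outside the active interval of a vertex need not be considered:
   an earliest arrival uses a time-edge at the vertex. *)
Definition spread (f : nat -> nat) : Prop :=
  (forall u, u \in ss -> f u = 0) /\
  (forall u, u \notin ss ->
     0 < f u /\ (f u <= max_time -> seen (f u) u /\ f u <= last_time u)).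

(** Sources are counted separately since they may lie on no time-edge; under [spread], any other
    vertex infected by [max_time] has been seen and therefore lies in [verts]. *)
Definition infected (t : nat) (f : nat -> nat) : nat :=
  size ss + count (fun u => (u \notin ss) && (f u <= t)) verts.

Definition deletions (t : nat) (f : nat -> nat) : nat :=
  \sum_(x <- ts | x.2 <= t) viol (phase x.2 f) x.

(* [active t] lists the paper's [F_t]; [alive t] lists the vertices that are
   shared by [F_t] and [F_(t+1)]. *)
Definition active (t : nat) (l : seq nat) : Prop :=
  uniq l /\ forall u, (u \in l) = seen t u && (t <= last_time u).

Definition alive (t : nat) (l : seq nat) : Prop :=
  uniq l /\ forall u, (u \in l) = seen t u && (t < last_time u).

Lemma seen_le t t' u : t <= t' -> seen t u -> seen t' u.
Proof.
move=> tt' /hasP[x xts /andP[xt ux]]; apply/hasP; exists x => //.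
by rewrite ux (leq_trans xt tt').
Qed.

Lemma seen_end x u : x \in ts -> u \in ends x -> seen x.2 u.
Proof. by move=> xts ux; apply/hasP; exists x => //; rewrite leqnn ux. Qed.

Lemma last_end x u : x \in ts -> u \in ends x -> x.2 <= last_time u.
Proof. by move=> xts ux; apply: (leq_bigmax_seq (F := snd)). Qed.

Lemma last_le u : last_time u <= max_time.
Proof.
apply/bigmax_leqP_seq => x xts _.
exact: (leq_bigmax_seq (F := snd)).
Qed.

Lemma seen_verts t u : seen t u -> u \in verts.
Proof.
case/hasP=> x xts /andP[_ ux]; rewrite mem_undup; apply/flattenP.
by exists (ends x) => //; apply: map_f.
Qed.

(** * One time step of the dynamic program *)

Section Step.
Variables (t0 : nat) (K B N : seq nat).
Hypotheses (aliveK : alive t0 K) (activeB : active t0.+1 B)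
  (aliveN : alive t0.+1 N) (lt_t0 : t0 < max_time).

(* [d] gives the phases at time [t0.+1]; [src] and [dst] are the codes of the
   infected sets before and after that time. *)
Definition src (d : nat -> nat) : nat := h.+1 * base3 K (fun u => d u == 2).
Definition dst (d : nat -> nat) : nat := h.+1 * base3 N (fun u => 0 < d u).
Definition fresh (d : nat -> nat) : nat := count (fun u => d u == 1) B.
(* A vertex that becomes active is infected at that moment iff it is a source. *)
Definition bad (d : nat -> nat) : bool :=
  has (fun u => if d u == 2 then (u \notin K) && (u \notin ss) else u \in ss) B.
(** No table entry exceeds [k.+1], so charging [k.+1] for an inconsistent placement makes the
    truncated subtraction return [0], the mark of infeasibility. *)
Definition charge (d : nat -> nat) : nat :=
  (if bad d then k.+1 else 0) + \sum_(x <- ts | x.2 == t0.+1) viol d x.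

Lemma alive_active u : u \in K -> u \in B.
Proof.
rewrite aliveK.2 activeB.2 => /andP[su lu].
by rewrite lu (seen_le _ su).
Qed.

Lemma alive_active_next u : u \in N -> u \in B.
Proof. by rewrite aliveN.2 activeB.2 => /andP[-> /ltnW]. Qed.

Lemma end_active x u : x \in ts -> x.2 = t0.+1 -> u \in ends x -> u \in B.
Proof.
by move=> xts xt ux; rewrite activeB.2 -xt seen_end //= last_end.
Qed.

(** Decoded digits are meaningful only on [B], whereas [phase] is total; all four quantities read
    [d] on [B] alone, since [K], [N] and the endpoints at time [t0.+1] lie in [B]. *)
Lemma eq_in_step d d' : {in B, d =1 d'} ->
  [/\ src d = src d', dst d = dst d', fresh d = fresh d' & charge d = charge d'].
Proof.
move=> dd'; split.
- by congr (_ * _); apply: eq_base3 => u uK; rewrite dd' // alive_active.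
- by congr (_ * _); apply: eq_base3 => u uK; rewrite dd' // alive_active_next.
- by apply: eq_in_count => u uB; rewrite dd'.
- congr (_ + _).
    by congr (if _ then _ else _); apply: eq_in_has => u uB; rewrite dd'.
  rewrite big_seq_cond [RHS]big_seq_cond; apply: eq_bigr => x.
  case/andP=> xts /eqP xt.
  have d1 : d x.1.1 = d' x.1.1.
    by apply: dd'; apply: end_active xt _; rewrite // mem_head.
  have d2 : d x.1.2 = d' x.1.2.
    by apply: dd'; apply: end_active xt _; rewrite // !inE eqxx orbT.
  by rewrite /viol d1 d2.
Qed.

(** [spread] places the infection inside the active interval of [u], so [u] has been seen by [t0],
    and membership in [B] keeps [last_time u] above [t0]. *)
Lemma spread_before f u : spread f -> u \in B -> u \notin ss ->
  f u <= t0 -> u \in K.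
Proof.
move=> [_ sf] uB uss ft; have [f0 [|sfu lfu]] := sf u uss.
  exact: leq_trans ft (ltnW lt_t0).
move: uB; rewrite activeB.2 aliveK.2 => /andP[_ ->].
by rewrite (seen_le ft sfu).
Qed.

Lemma spread_step f : spread f ->
  let d := phase t0.+1 f in
  [/\ src d = h.+1 * base3 K (fun u => f u <= t0),
      dst d = h.+1 * base3 N (fun u => f u <= t0.+1),
      infected t0.+1 f = infected t0 f + fresh d
    & deletions t0.+1 f = deletions t0 f + charge d].
Proof.
move=> sf d; split.
- by congr (_ * _); apply: eq_base3 => u _; rewrite /d /phase; lia.
- by congr (_ * _); apply: eq_base3 => u _; rewrite /d /phase; lia.
- rewrite /infected -addnA; congr (_ + _).
  have -> : fresh d = count (fun u => (u \notin ss) && (f u == t0.+1)) verts.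
    rewrite /fresh -!size_filter; apply/perm_size/uniq_perm.
    + by rewrite filter_uniq // activeB.1.
    + by rewrite filter_uniq // undup_uniq.
    move=> u; rewrite !mem_filter.
    have -> : (d u == 1) = (f u == t0.+1) by rewrite /d /phase; lia.
    case: eqP => [fu|]; last by rewrite andbF.
    rewrite andbT /=; case: (boolP (u \in ss)) => /= uss.
      by rewrite (sf.1 u uss) in fu.
    have [_ []] := sf.2 u uss; first by rewrite fu.
    rewrite fu activeB.2 => su ->; rewrite su.
    by rewrite (seen_verts su).
  rewrite -count_predUI [X in _ + X](@eq_count _ _ pred0); last first.
    by move=> u /=; case: (u \in ss) => //=; lia.
  rewrite count_pred0 addn0.
  by apply: eq_count => u /=; case: (u \in ss) => //=; lia.
(* The phases of a spread are never bad: in [B], phase 2 outside the sources forces membership in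
   [K], and sources are always in phase 2. *)
- rewrite /deletions /charge ifF ?add0n.
    rewrite (bigID (fun x => x.2 <= t0)) /=; congr (_ + _).
      by apply: eq_bigl => x; lia.
    rewrite (eq_bigl (fun x => x.2 == t0.+1)); last by move=> x /=; lia.
    by apply: eq_bigr => x /eqP ->.
  apply/hasPn => u uB; rewrite /d /phase.
  case: (boolP (u \in ss)) => uss; first by rewrite (sf.1 u uss) andbF.
  case: ifP => // /eqP ft; rewrite andbT negbK.
  by apply: (spread_before sf uB uss); lia.
Qed.

(** Any consistent placement can follow any past with the same infected subset of [K]: times up to
    [t0] are kept and only later ones are chosen anew, which affects no count and no deletion up to
    [t0]. *)
Lemma spread_extend f d : spread f -> (forall u, d u < 3) -> ~~ bad d ->
  src d = h.+1 * base3 K (fun u => f u <= t0) ->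
  exists f', [/\ spread f', {in B, d =1 phase t0.+1 f'},
    infected t0 f' = infected t0 f & deletions t0 f' = deletions t0 f].
Proof.
move=> sf d3 /hasPn nbad eqsrc.
(* On [K] the equality of codes decides. Outside [K], a placement that is not bad gives phase 2 to
   the sources only, and [f] infects no other such vertex of [B] by [t0]. *)
have old u : u \in B -> (d u == 2) = (f u <= t0).
  move=> uB; have := nbad u uB; case: (boolP (u \in K)) => uK /= nb.
    have eqK : base3 K (fun u => d u == 2) = base3 K (fun u => f u <= t0).
      by move/eqP: eqsrc; rewrite eqn_mul2l /= => /eqP.
    have b3 (b : bool) : b < 3 by case: b.
    have := base3_inj (fun u => b3 (d u == 2)) (fun u => b3 (f u <= t0)) eqK uK.
    by case: (d u == 2); case: (f u <= t0).
  move: nb; case: (boolP (u \in ss)) => uss /=.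
    by rewrite (sf.1 _ uss); case: eqP.
  case: eqP => //= _ _; apply/esym/negP => ft.
  by rewrite (spread_before sf uB uss ft) in uK.
(* Whatever is infected neither by [t0] nor at [t0.+1] is postponed for ever by the value
   [max_time.+1]; its later fate is the concern of later steps. *)
pose f' u := if f u <= t0 then f u else
             if (u \in B) && (d u == 1) then t0.+1 else max_time.+1.
have f'le s u : s <= t0 -> (f' u <= s) = (f u <= s).
  by move=> st; rewrite /f'; case: ifP => // ft; case: ifP => _; lia.
have f'lt s u : s <= t0 -> (f' u < s) = (f u < s).
  case: s => // s /ltnW st.
  by rewrite !ltnS f'le.
exists f'; split.
- split=> u uss; first by rewrite /f' (sf.1 u uss).
  rewrite /f'; case: ifP => ft; first exact: sf.2.
  case: ifP => [/andP[uB du]|_]; last by split=> //; rewrite ltnn.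
  by split=> // _; apply/andP; rewrite -activeB.2.
- move=> u uB; have := old u uB; have := d3 u.
  rewrite /phase /f' uB /=; case: (leqP (f u) t0) => ft /=; first by lia.
  by case: (d u =P 1) => [->|]; lia.
- by congr (_ + _); apply: eq_count => u; rewrite f'le.
- by apply: eq_bigr => x xt; rewrite /viol /phase !f'le // !f'lt.
Qed.

End Step.

(** The two clauses pin each entry to the maximum of the truncated [k.+1 - deletions t f] over the
    [f] with that index, and to [0] if there is none, without naming a maximum. *)
Definition table_ok (t : nat) (K : seq nat) (T : nat -> nat) (off : nat) : Prop :=
  (forall x, 0 < T (off + x) -> exists f,
     [/\ spread f, infected t f <= h, T (off + x) + deletions t f <= k.+1
       & x = h.+1 * base3 K (fun u => f u <= t) + infected t f]) /\
  (forall f, spread f -> infected t f <= h ->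
     k.+1 <= T (off + (h.+1 * base3 K (fun u => f u <= t) + infected t f))
             + deletions t f).

Definition relaxed (t0 : nat) (K B N : seq nat) (T0 : nat -> nat) (off0 : nat)
    (T1 : nat -> nat) (off1 : nat) : Prop :=
  (forall q r, let d := digit B q in q < 3 ^ size B -> r + fresh B d <= h ->
     T0 (off0 + (src K d + r)) - charge t0 K B d
       <= T1 (off1 + (dst N d + (r + fresh B d)))) /\
  (forall x, 0 < T1 (off1 + x) -> exists q r, let d := digit B q in
     [/\ r + fresh B d <= h, x = dst N d + (r + fresh B d)
       & T1 (off1 + x) <= T0 (off0 + (src K d + r)) - charge t0 K B d]).

Lemma table_step t0 K B N T0 off0 T1 off1 :
  alive t0 K -> active t0.+1 B -> alive t0.+1 N -> t0 < max_time ->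
  table_ok t0 K T0 off0 -> relaxed t0 K B N T0 off0 T1 off1 ->
  table_ok t0.+1 N T1 off1.
Proof.
move=> aK aB aN lt_t0 [sound0 compl0] [compl1 sound1]; split.
- move=> x T1x; have [q [r [rh xE T1le]]] := sound1 x T1x.
  set d := digit B q in rh xE T1le.
  have T0x : 0 < T0 (off0 + (src K d + r)) by lia.
  have [f [sf fh T0f eqx]] := sound0 _ T0x.
  (* Both counts are at most [h], so division by [h.+1] separates the index into set code and
     count. *)
  have [eqr eqs] : r = infected t0 f /\ src K d = h.+1 * base3 K (fun u => f u <= t0).
    have rh' : r < h.+1 by lia.
    have fh' : infected t0 f < h.+1 by lia.
    have := congr1 (modn^~ h.+1) eqx; have := congr1 (divn^~ h.+1) eqx.
    rewrite /src ![h.+1 * _]mulnC !divnMDl // !modnMDl !modn_small //.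
    by rewrite !divn_small // !addn0 => -> ->.
  have nbad : ~~ bad K B d.
    by apply/negP => bd; move: T1le; rewrite /charge bd; lia.
  have [f' [sf' df' inf del]] :=
    spread_extend aK aB lt_t0 sf (@digit_lt3 B q) nbad eqs.
  have [es ed ef ec] := eq_in_step aK aB aN df'.
  have [ps pd pf pc] := spread_step N aK aB lt_t0 sf'.
  exists f'; split=> //.
  + by rewrite pf -ef inf -eqr.
  + by rewrite pc -ec del -/d; lia.
  + by rewrite pf -ef inf -eqr -pd -ed.
- move=> f sf fh; have [ps pd pf pc] := spread_step N aK aB lt_t0 sf.
  set d := phase t0.+1 f in ps pd pf pc.
  have d3 u : d u < 3 by rewrite /d /phase; lia.
  have dd := digit_base3 aB.1 d3.
  have [es ed ef ec] := eq_in_step aK aB aN dd.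
  have := compl1 (base3 B d) (infected t0 f) (base3_lt _ d3).
  rewrite es ed ef ec -pf ps pd pc => /(_ fh).
  have := compl0 f sf; rewrite pf in fh * => /(_ (leq_trans (leq_addr _ _) fh)).
  by lia.
Qed.

Lemma seen0 u : ~~ seen 0 u.
Proof. by apply/hasPn => x xts; rewrite leqNgt ts_pos. Qed.

Lemma alive0 : alive 0 [::].
Proof. by split=> // u; rewrite (negbTE (seen0 u)). Qed.

Lemma alive_max K : alive max_time K -> K = [::].
Proof.
case: K => // u K [_ /(_ u)]; rewrite mem_head ltnNge last_le andbF //.
Qed.

Lemma table_init T : size ss <= h ->
  (forall x, T x = if x == size ss then k.+1 else 0) ->
  table_ok 0 [::] T 0.
Proof.
move=> ssh TE.
have inf0 f : spread f -> infected 0 f = size ss.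
  move=> sf; rewrite /infected (@eq_count _ _ pred0) ?count_pred0 ?addn0 //.
  move=> u /=; case: (boolP (u \in ss)) => //= uss.
  by have [] := sf.2 u uss; lia.
have del0 f : deletions 0 f = 0.
  rewrite /deletions big_seq_cond big_pred0 // => x; apply/negbTE/negP.
  by case/andP=> xts; rewrite leqNgt ts_pos.
have sf0 : spread (fun u => if u \in ss then 0 else max_time.+1).
  split=> u; first by move=> ->.
  by move/negbTE ->; split=> //; rewrite ltnn.
split=> [x|f sf _]; last by rewrite del0 inf0 //= muln0 !add0n TE eqxx addn0.
rewrite add0n TE; case: eqP => // ->.
exists (fun u => if u \in ss then 0 else max_time.+1).
by rewrite inf0 // del0 muln0 addn0.
Qed.

(** No vertex is alive after [max_time], so the index has shrunk to the count; a positive entry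
    leaves at least one unit of [k.+1], that is, at most [k] deletions. *)
Lemma table_final T off : table_ok max_time [::] T off ->
  (exists2 r, r <= h & 0 < T (off + r)) <->
  (exists f, [/\ spread f, infected max_time f <= h & deletions max_time f <= k]).
Proof.
case=> sound compl; split.
- by case=> r rh Tr; have [f [sf fh ? _]] := sound r Tr; exists f; split=> //; lia.
- case=> f [sf fh fk]; exists (infected max_time f) => //.
  by have := compl f sf fh; rewrite /= muln0 add0n; lia.
Qed.

End Dynamic.

(** * Running time of structured programs *)

Fixpoint mod_vars (c : cmd) : seq nat :=
  match c with
  | Assign x _ => [:: x]
  | Seq c1 c2 | If _ c1 c2 => mod_vars c1 ++ mod_vars c2
  | While _ c => mod_vars c
  | _ => [::]
  end.

Fixpoint mod_arrs (c : cmd) : seq nat :=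
  match c with
  | Write a _ _ => [:: a]
  | Seq c1 c2 | If _ c1 c2 => mod_arrs c1 ++ mod_arrs c2
  | While _ c => mod_arrs c
  | _ => [::]
  end.

(** The lists of touched variables and arrays are syntactic, so for a concrete command the side
    conditions are settled by computation. *)
Definition frame (c : cmd) (s s' : state) : Prop :=
  (forall x, x \notin mod_vars c -> vars s' x = vars s x) /\
  (forall a, a \notin mod_arrs c -> arrs s' a = arrs s a).

Lemma frame_trans c s1 s2 s3 : frame c s1 s2 -> frame c s2 s3 -> frame c s1 s3.
Proof.
by move=> [v1 a1] [v2 a2]; split=> x xc; rewrite ?v2 ?v1 // ?a2 ?a1.
Qed.

Lemma frame_seq c1 c2 s1 s2 s3 :
  frame c1 s1 s2 -> frame c2 s2 s3 -> frame (Seq c1 c2) s1 s3.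
Proof.
move=> [v1 a1] [v2 a2]; split=> x; rewrite mem_cat negb_or => /andP[x1 x2].
  by rewrite v2 ?v1.
by rewrite a2 ?a1.
Qed.

Lemma exec_frame c s T s' : exec c s T s' -> frame c s s'.
Proof.
elim=> {c s T s'} //.
- by move=> x e s; split=> // y; rewrite inE /= /upd => /negbTE ->.
- by move=> a i e s; split=> // y; rewrite inE /= /upd => /negbTE ->.
- by move=> c1 c2 s1 s2 s3 T1 T2 _ + _; apply: frame_seq.
- move=> e c1 c2 s s' T _ _ [v1 a1].
  by split=> x; rewrite mem_cat negb_or => /andP[x1 x2]; rewrite ?v1 ?a1.
- move=> e c1 c2 s s' T _ _ [v1 a1].
  by split=> x; rewrite mem_cat negb_or => /andP[x1 x2]; rewrite ?v1 ?a1.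
- by move=> e c s1 s2 s3 T1 T2 _ _ + _; apply: frame_trans.
Qed.

(** A total-correctness triple: [exec] records the exact time, [run] only an upper bound, which can
    be weakened to a closed form. *)
Definition run (c : cmd) (s : state) (t : nat) (Q : state -> Prop) : Prop :=
  exists T s', [/\ exec c s T s', T <= t & Q s'].

Lemma run_weaken c s t t' (Q Q' : state -> Prop) :
  run c s t Q -> t <= t' -> (forall s', frame c s s' -> Q s' -> Q' s') ->
  run c s t' Q'.
Proof.
move=> [T [s' [ex Tt Qs']]] tt' QQ'; exists T, s'; split=> //.
  exact: leq_trans tt'.
by apply: QQ' => //; apply: exec_frame ex.
Qed.

Lemma run_seq c1 c2 s t1 t2 (Q1 Q2 : state -> Prop) :
  run c1 s t1 Q1 ->
  (forall s', frame c1 s s' -> Q1 s' -> run c2 s' t2 Q2) ->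
  run (Seq c1 c2) s (t1 + t2) Q2.
Proof.
move=> [T1 [s1 [ex1 Tt1 Q1s]]] /(_ _ (exec_frame ex1) Q1s)[T2 [s2 [ex2 Tt2 Q2s]]].
by exists (T1 + T2), s2; split=> //; [apply: ExecSeq ex1 ex2 | apply: leq_add].
Qed.

Lemma run_if e c1 c2 s t1 t2 (Q : state -> Prop) :
  (eval s e != 0 -> run c1 s t1 Q) -> (eval s e = 0 -> run c2 s t2 Q) ->
  run (If e c1 c2) s (ecost e + maxn t1 t2).+1 Q.
Proof.
move=> r1 r2; case: (eqVneq (eval s e) 0) => [e0|e1].
  have [T [s' [ex Tt Qs]]] := r2 e0; exists (ecost e + T).+1, s'; split=> //.
    by apply: ExecIfFalse ex; rewrite e0.
  by rewrite ltnS leq_add2l leq_max Tt orbT.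
have [T [s' [ex Tt Qs]]] := r1 e1; exists (ecost e + T).+1, s'; split=> //.
  exact: ExecIfTrue ex.
by rewrite ltnS leq_add2l leq_max Tt.
Qed.

(** Every loop here has a number of rounds known in advance, so the invariant is indexed by the
    rounds done and no variant is required. The frame from the entry state [s0] spares the
    invariants all data that the body leaves alone. *)
Lemma run_while e c (I : nat -> state -> Prop) N t s0 :
  (forall j s, j < N -> frame c s0 s -> I j s ->
     eval s e != 0 /\ run c s t (I j.+1)) ->
  (forall s, frame c s0 s -> I N s -> eval s e = 0) -> I 0 s0 ->
  run (While e c) s0 (N * (t + ecost e).+1 + (ecost e).+1) (I N).
Proof.
move=> body stop I0.
suff loop m : forall j s, j + m = N -> frame c s0 s -> I j s ->
    run (While e c) s (m * (t + ecost e).+1 + (ecost e).+1) (I N).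
  exact: (loop N 0).
elim: m => [|m IHm] j s jN fr Is.
  rewrite addn0 in jN; subst j; exists (ecost e).+1, s; split=> //.
  by apply: ExecWhileFalse; rewrite (stop s fr).
have lt_jN : j < N by lia.
have [ev [T1 [s1 [ex1 Tt1 I1]]]] := body j s lt_jN fr Is.
have eqN : j.+1 + m = N by lia.
have [T2 [s2 [ex2 Tt2 I2]]] := IHm j.+1 s1 eqN (frame_trans fr (exec_frame ex1)) I1.
exists (ecost e + T1 + T2).+1, s2; split=> //; last by lia.
exact: ExecWhileTrue ev ex1 ex2.
Qed.

(** Loop-free commands are executed by computing [effect], so their triples reduce to
    simplification. *)
Fixpoint straight (c : cmd) : bool :=
  match c with
  | Seq c1 c2 | If _ c1 c2 => straight c1 && straight c2
  | While _ _ => false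
  | _ => true
  end.

Fixpoint effect (c : cmd) (s : state) : state :=
  match c with
  | Assign x e => State (upd (vars s) x (eval s e)) (arrs s)
  | Write a i e =>
      State (vars s) (upd (arrs s) a (upd (arrs s a) (eval s i) (eval s e)))
  | Seq c1 c2 => effect c2 (effect c1 s)
  | If e c1 c2 => if eval s e is 0 then effect c2 s else effect c1 s
  | _ => s
  end.

Fixpoint max_cost (c : cmd) : nat :=
  match c with
  | Assign _ e => (ecost e).+1
  | Write _ i e => (ecost i + ecost e).+1
  | Seq c1 c2 => max_cost c1 + max_cost c2
  | If e c1 c2 => (ecost e + maxn (max_cost c1) (max_cost c2)).+1
  | _ => 1
  end.

Lemma exec_straight c s : straight c ->
  exists2 T, exec c s T (effect c s) & T <= max_cost c.
Proof.
elim: c s => //=.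
- by move=> s _; exists 1 => //; apply: ExecSkip.
- by move=> x e s _; exists (ecost e).+1 => //; apply: ExecAssign.
- by move=> a i e s _; exists (ecost i + ecost e).+1 => //; apply: ExecWrite.
- move=> c1 IH1 c2 IH2 s /andP[sc1 sc2].
  have [T1 ex1 Tt1] := IH1 s sc1; have [T2 ex2 Tt2] := IH2 (effect c1 s) sc2.
  by exists (T1 + T2); [apply: ExecSeq ex1 ex2 | apply: leq_add].
- move=> e c1 IH1 c2 IH2 s /andP[sc1 sc2].
  case E: (eval s e) => [|m].
    have [T ex Tt] := IH2 s sc2; exists (ecost e + T).+1; last by lia.
    by apply: ExecIfFalse ex; rewrite E.
  have [T ex Tt] := IH1 s sc1; exists (ecost e + T).+1; last by lia.
  by apply: ExecIfTrue ex; rewrite E.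
Qed.

Lemma effect_frame c s : straight c -> frame c s (effect c s).
Proof. by case/(exec_straight s)=> T ex _; apply: exec_frame ex. Qed.

Lemma run_straight c s (Q : state -> Prop) :
  straight c -> Q (effect c s) -> run c s (max_cost c) Q.
Proof. by case/(exec_straight s)=> T ex Tt Qs; exists T, (effect c s). Qed.

(** * The program *)

(* Cells up to 5 hold the input; the result overwrites [n].  The current bag is
   the segment of length [xB] of [aBag] at [xO], the current table starts at cell
   [xOff] of [aTab], and the next ones have size [xB2] and offset [xOff2].  [aOld]
   and [aNew] give the weight of a vertex in the current and in the next table. *)
Local Notation xRes := 0 (only parsing).
Local Notation xK := 1 (only parsing).
Local Notation xH := 2 (only parsing).
Local Notation xS := 3 (only parsing).
Local Notation xM := 5 (only parsing).
Local Notation xLam := 6 (only parsing).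
Local Notation xT := 7 (only parsing).
Local Notation xB := 8 (only parsing).
Local Notation xB2 := 9 (only parsing).
Local Notation xO := 10 (only parsing).
Local Notation xOff := 11 (only parsing).
Local Notation xOff2 := 12 (only parsing).
Local Notation xE := 13 (only parsing).
Local Notation xI := 14 (only parsing).
Local Notation xQ := 15 (only parsing).
Local Notation xRem := 16 (only parsing).
Local Notation xSrc := 17 (only parsing).
Local Notation xDst := 18 (only parsing).
Local Notation xNew := 19 (only parsing).
Local Notation xCost := 20 (only parsing).
Local Notation xR := 21 (only parsing).
Local Notation xU := 22 (only parsing).
Local Notation xV := 23 (only parsing).

Local Notation aS := 0 (only parsing).
Local Notation aU := 3 (only parsing).
Local Notation aV := 4 (only parsing).
Local Notation aTime := 5 (only parsing).
Local Notation aIns := 6 (only parsing).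
Local Notation aHead := 7 (only parsing).
Local Notation aNext := 8 (only parsing).
Local Notation aLast := 9 (only parsing).
Local Notation aSeen := 10 (only parsing).
Local Notation aBag := 11 (only parsing).
Local Notation aPow := 12 (only parsing).
Local Notation aOld := 13 (only parsing).
Local Notation aNew := 14 (only parsing).
Local Notation aDig := 15 (only parsing).
Local Notation aTab := 16 (only parsing).

Local Notation "x ::= e" := (Assign x e) (at level 60, e at level 50).
Local Notation "a !! i ::= e" := (Write a i e)
  (at level 60, i at level 50, e at level 50).
Local Notation "c1 ;; c2" := (Seq c1 c2) (at level 65, right associativity).
Local Notation "$ x" := (Var x) (at level 8, x at level 0).
Local Notation "# x" := (Cst x) (at level 8, x at level 0).
Local Notation "a .@ i" := (Read a i) (at level 9, i at level 8).
Local Notation "x \+ y" := (Add x y) (at level 50, left associativity).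
Local Notation "x \- y" := (Defs.Sub x y) (at level 50, left associativity).

Definition mark : cmd :=
  xI ::= #0 ;;
  While ($xS \- $xI) (aIns !! aS .@ $xI ::= #1 ;; xI ::= $xI \+ #1).

(* The maximum of x and y is computed as [x + (y - x)], with truncated [-]. *)
Definition set_max (a x y : nat) : cmd :=
  a !! $x ::= a .@ $x \+ ($y \- a .@ $x).

(** Bucket sort by insertion at the head of one linked list per time; the same pass finds the
    largest time and the last time of each vertex. *)
Definition sort_step : cmd :=
    xT ::= aTime .@ $xI ;;
    aNext !! $xI ::= aHead .@ $xT ;;
    aHead !! $xT ::= $xI \+ #1 ;;
    xLam ::= $xLam \+ ($xT \- $xLam) ;;
    xU ::= aU .@ $xI ;; set_max aLast xU xT ;;
    xU ::= aV .@ $xI ;; set_max aLast xU xT ;;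
    xI ::= $xI \+ #1.

Definition sort_edges : cmd := xI ::= #0 ;; While ($xM \- $xI) sort_step.

(** [aSeen] is never cleared: a vertex seen earlier that still has a time-edge is already in the
    bag. Each insertion also triples the last power by additions, so that [aPow] always reaches up
    to the bag size. *)
Definition insert : cmd :=
  If (aSeen .@ $xU) Skip
    (aSeen !! $xU ::= #1 ;;
     aBag !! $xO \+ $xB ::= $xU ;;
     aPow !! $xB \+ #1 ::= aPow .@ $xB \+ (aPow .@ $xB \+ aPow .@ $xB) ;;
     xB ::= $xB \+ #1).

Definition collect_step : cmd :=
    (xI ::= $xE \- #1 ;; xU ::= aU .@ $xI) ;; insert ;;
    xU ::= aV .@ $xI ;; insert ;;
    xE ::= aNext .@ $xI.

Definition collect : cmd := xE ::= aHead .@ $xT ;; While ($xE) collect_step.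

Definition layout_step : cmd :=
    xU ::= aBag .@ ($xO \+ $xI) ;;
    aOld !! $xU ::= aNew .@ $xU ;;
    If (aLast .@ $xU \- $xT)
      (aNew !! $xU ::= aPow .@ $xB2 ;;
       aBag !! $xO \+ $xB \+ $xB2 ::= $xU ;;
       xB2 ::= $xB2 \+ #1)
      (aNew !! $xU ::= #0) ;;
    xI ::= $xI \+ #1.

Definition layout : cmd :=
  (xI ::= #0 ;; xB2 ::= #0) ;; While ($xB \- $xI) layout_step.

(** Base 3 digits are read from the most significant one down by at most two subtractions of the
    power [p]; [xRem + 1 - p] is nonzero exactly when [p <= xRem]. The number decoded comes in units
    of [h.+1], the scale of [aPow]. *)
Definition decode_step : cmd :=
    (xI ::= $xI \- #1 ;; xU ::= aBag .@ ($xO \+ $xI)) ;;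
    If ($xRem \+ #1 \- aPow .@ $xI)
      ((xRem ::= $xRem \- aPow .@ $xI ;; xDst ::= $xDst \+ aNew .@ $xU) ;;
       If ($xRem \+ #1 \- aPow .@ $xI)
         (xRem ::= $xRem \- aPow .@ $xI ;;
          aDig !! $xU ::= #2 ;;
          xSrc ::= $xSrc \+ aOld .@ $xU ;;
          If (aOld .@ $xU \+ aIns .@ $xU) Skip (xCost ::= $xK \+ #1))
         (aDig !! $xU ::= #1 ;;
          xNew ::= $xNew \+ #1 ;;
          If (aIns .@ $xU) (xCost ::= $xK \+ #1) Skip))
      (aDig !! $xU ::= #0 ;;
       If (aIns .@ $xU) (xCost ::= $xK \+ #1) Skip).

Definition decode : cmd :=
  (xRem ::= $xQ ;; xI ::= $xB ;; xSrc ::= $xOff ;; xDst ::= $xOff2 ;;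
   xNew ::= #0 ;; xCost ::= #0) ;;
  While ($xI) decode_step.

Definition add_charge_step : cmd :=
    xI ::= $xE \- #1 ;;
    xU ::= aU .@ $xI ;;
    xV ::= aV .@ $xI ;;
    xCost ::= $xCost \+ ((aDig .@ $xU \- aDig .@ $xV \- #1)
                         \+ (aDig .@ $xV \- aDig .@ $xU \- #1)) ;;
    xE ::= aNext .@ $xI.

Definition add_charge : cmd := xE ::= aHead .@ $xT ;; While ($xE) add_charge_step.

Definition relax_step : cmd :=
    xV ::= $xDst \+ $xNew \+ $xR ;;
    aTab !! $xV ::= aTab .@ $xV \+ (aTab .@ ($xSrc \+ $xR) \- $xCost \- aTab .@ $xV) ;;
    xR ::= $xR \+ #1.

Definition relax : cmd := xR ::= #0 ;; While ($xH \+ #1 \- $xNew \- $xR) relax_step.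

Definition pass : cmd := decode ;; add_charge ;; relax.

(* Each table and each bag is written to fresh, hence zero, cells: this is why
   no clearing is needed. *)
Definition sweep : cmd :=
  (xOff2 ::= $xOff \+ aPow .@ $xB ;; xQ ::= #0) ;;
  While (aPow .@ $xB \- $xQ) (pass ;; xQ ::= $xQ \+ aPow .@ #0).

Definition step : cmd :=
  xT ::= $xT \+ #1 ;; collect ;; layout ;; sweep ;;
  xOff ::= $xOff2 ;; xO ::= $xO \+ $xB ;; xB ::= $xB2.

Definition finish : cmd :=
  (xR ::= #0 ;; xRes ::= #0) ;;
  While ($xH \+ #1 \- $xR)
    (xRes ::= $xRes \+ aTab .@ ($xOff \+ $xR) ;; xR ::= $xR \+ #1).

Definition body : cmd :=
  mark ;; sort_edges ;;
  (xT ::= #0 ;; aPow !! #0 ::= $xH \+ #1 ;; aTab !! $xS ::= $xK \+ #1) ;;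
  While ($xLam \- $xT) step ;; finish.

(** The guards settle the instances for which the product in the time bound may vanish: beyond them
    there are a source, hence a positive [h], and a time-edge. *)
Definition program : cmd :=
  If ($xS \- $xH) (xRes ::= #0)
    (If ($xS) (If ($xM) body (xRes ::= #1)) (xRes ::= #1)).

(** * Correctness and cost of the program *)

Section Program.
Variables (k h : nat) (ss : seq nat) (ts : seq (nat * nat * nat)).
Hypothesis ts_pos : forall x, x \in ts -> 0 < x.2.
Hypothesis ss_h : size ss <= h.

Let edge (i : nat) := nth (0, 0, 0) ts i.
Let m := size ts.

(** Largest index first, the order that insertion at the head produces. *)
Fixpoint bucket (t i : nat) : seq nat :=
  if i is j.+1 then if (edge j).2 == t then j :: bucket t j else bucket t j
  else [::].

(* Pointers in the linked lists of time-edges are shifted by one; 0 ends a list. *)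
Definition head_code (l : seq nat) : nat := if l is j :: _ then j.+1 else 0.

(** The list at time [t] restricted to indices below [b] is both the tail after [b] and what [aNext]
    recorded when [b] was inserted, so following pointers walks through [bucket]. *)
Lemma bucket_drop t i j : j < size (bucket t i) ->
  let b := nth 0 (bucket t i) j in
  [/\ head_code (drop j (bucket t i)) = b.+1, b < i, (edge b).2 = t
    & bucket t b = drop j.+1 (bucket t i)].
Proof.
elim: i j => // i IHi j /=; case: eqP => [et|_] /= lt_j; last first.
  by have [? ? ? ?] := IHi j lt_j; split=> //; apply: ltnW.
case: j lt_j => [|j] lt_j; first by rewrite /= drop0.
by have [? ? ? ?] := IHi j lt_j; split=> //; apply: ltnW.
Qed.

Lemma sum_bucket t i (F : nat * nat * nat -> nat) : i <= m ->
  \sum_(j <- bucket t i) F (edge j) = \sum_(x <- take i ts | x.2 == t) F x.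
Proof.
elim: i => [|i IHi] im /=; first by rewrite take0 !big_nil.
rewrite (take_nth (0, 0, 0)) // big_rcons /= -/(edge i).
by case: ifP => _; rewrite ?big_cons IHi ?(ltnW im) // addnC.
Qed.

Lemma size_bucket t i : i <= m ->
  size (bucket t i) = count (fun x => x.2 == t) (take i ts).
Proof.
by move=> im; rewrite -sum1_size (sum_bucket t (fun=> 1) im) sum1_count.
Qed.

Lemma run_mark s : vars s xS = size ss ->
  arrs s aS = nth 0 ss -> arrs s aIns = (fun=> 0) ->
  run mark s (20 * (size ss).+1) (fun s' => arrs s' aIns = (fun u => u \in ss : nat)).
Proof.
move=> sS aSE aI.
pose I j s := vars s xI = j /\
   forall u, arrs s aIns u = (u \in take j ss).
eapply run_weaken with (Q := I (size ss)).
- eapply run_seq with (Q1 := I 0).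
    by apply: run_straight => //; split=> //= u; rewrite aI take0.
  move=> s1 [fv fa] I1; eapply run_while => //.
  + move=> j s2 lt_j [fv2 fa2] [ij insj]; split.
      by rewrite /= fv2 // fv // sS ij subn_eq0 -ltnNge.
    apply: run_straight => //; split; first by rewrite /= /upd /= ij addn1.
    move=> u; rewrite /= /upd /= fa2 // fa // aSE ij (take_nth 0) // mem_rcons inE insj.
    by case: eqP.
  + by move=> s2 [fv2 fa2] [ij _]; rewrite /= fv2 // fv // sS ij subnn.
- by rewrite /=; lia.
- by move=> s' _ [_ E]; apply: functional_extensionality => u; rewrite E take_size.
Qed.

Definition sorted_upto (j : nat) (s : state) : Prop :=
  [/\ forall t, arrs s aHead t = head_code (bucket t j),
      forall i, i < j -> arrs s aNext i = head_code (bucket (edge i).2 i),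
      forall u, arrs s aLast u = last_time (take j ts) u
    & vars s xLam = max_time (take j ts)].

Lemma run_sort s : vars s xM = m -> vars s xLam = 0 ->
  arrs s aU = (fun i => (edge i).1.1) -> arrs s aV = (fun i => (edge i).1.2) ->
  arrs s aTime = (fun i => (edge i).2) ->
  arrs s aHead = (fun=> 0) -> arrs s aLast = (fun=> 0) ->
  run sort_edges s (100 * m.+1) (sorted_upto m).
Proof.
move=> sM sL aUE aVE aTE aH0 aL0.
pose I j s := vars s xI = j /\ sorted_upto j s.
eapply run_weaken with (Q := I m).
- eapply run_seq with (Q1 := I 0).
    apply: run_straight => //; split=> //; split=> //=.
    + by move=> t; rewrite aH0.
    + by move=> u; rewrite aL0 take0 /last_time big_nil.
    + by rewrite /upd /= sL take0 /max_time big_nil.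
  move=> s1 [fv fa] I1; eapply run_while => //.
  + move=> j s2 lt_j [fv2 fa2] [ij [hd nx la mx]]; split.
      by rewrite /= fv2 // fv // sM ij subn_eq0 -ltnNge.
    apply: run_straight => //; split; first by rewrite /= /upd /= ij addn1.
    have [tE uE vE] : [/\ arrs s2 aTime = (fun i => (edge i).2),
      arrs s2 aU = (fun i => (edge i).1.1) & arrs s2 aV = (fun i => (edge i).1.2)].
      by split; rewrite fa2 // fa.
    split.
    * by move=> t; rewrite /= /upd /= ij tE addn1 eq_sym; case: eqP.
    * move=> i; rewrite ltnS leq_eqVlt /= /upd /= ij tE.
      by case: eqP => [-> _|_ /= lt_ij]; rewrite ?hd ?nx.
    * move=> u; rewrite /= /upd /= !ij tE uE vE (take_nth (0,0,0)) // -/(edge j).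
      rewrite /last_time big_rcons /= -/(last_time _ _) !inE !la.
      case: (u =P (edge j).1.1) => [->|ne1] /=.
        case: ((edge j).1.1 =P (edge j).1.2) => [->|ne2]; first by rewrite eqxx; lia.
        by lia.
      case: (u =P (edge j).1.2) => [E2|ne2]; last by rewrite maxn0.
      by rewrite -E2; case: eqP => // _; lia.
    * rewrite /= /upd /= !ij tE mx (take_nth (0,0,0)) // -/(edge j).
      by rewrite /max_time big_rcons /=; lia.
  + by move=> s2 [fv2 fa2] [ij _]; rewrite /= fv2 // fv // sM ij subnn.
- by rewrite /=; lia.
- by move=> s' _ [_ E].
Qed.

Definition base (s : state) : Prop :=
  [/\ vars s xK = k, vars s xH = h,
      arrs s aU = (fun i => (edge i).1.1), arrs s aV = (fun i => (edge i).1.2)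
    & [/\ arrs s aHead = (fun t => head_code (bucket t m)),
          forall i, i < m -> arrs s aNext i = head_code (bucket (edge i).2 i),
          arrs s aLast = last_time ts
        & arrs s aIns = (fun u => u \in ss : nat)]].

(** Boolean, so that for each concrete command the proof is [isT]. *)
Definition keeps_base (c : cmd) : bool :=
  all (fun x => x \notin mod_vars c) [:: xK; xH] &&
  all (fun a => a \notin mod_arrs c) [:: aU; aV; aHead; aNext; aLast; aIns].

Lemma base_frame c s s' : frame c s s' -> keeps_base c -> base s -> base s'.
Proof.
move=> [fv fa] /andP[/allP kv /allP ka] [bK bH bU bV [bHd bN bL bI]].
by split; rewrite ?(fv _ (kv _ _)) ?(fa _ (ka _ _)).
Qed.

Definition has_bag (B : seq nat) (s : state) : Prop :=
  [/\ vars s xB = size B,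
      forall i, i < size B -> arrs s aBag (vars s xO + i) = nth 0 B i
    & forall i, i <= size B -> arrs s aPow i = h.+1 * 3 ^ i].

Definition collected (t0 : nat) (K : seq nat) (A : pred nat) (s : state) : Prop :=
  exists B, [/\ uniq B, has_bag B s, forall u, (u \in B) = (u \in K) || A u
    & forall u, (arrs s aSeen u != 0) = seen ts t0 u || A u].

(** An endpoint at the current time still has a time-edge after [t0], so it was seen by [t0] iff it
    is in [K]. This is the first hypothesis, and it makes the test of [aSeen] a test of membership
    in the bag. *)
Lemma collected_insert t0 K A s : seen ts t0 (vars s xU) = (vars s xU \in K) ->
  collected t0 K A s ->
  collected t0 K (fun u => A u || (u == vars s xU)) (effect insert s).
Proof.
move=> seenK [B [UB [bB nB pB] BE SE]]; have := SE (vars s xU).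
rewrite seenK -BE /=; case: (arrs s aSeen (vars s xU)) => [|c] /= /esym uB; last first.
  exists B; split=> // u; rewrite orbA.
    by rewrite -BE; case: (u =P _) => [->|_]; rewrite ?orbF ?uB.
  rewrite -SE; case: (u =P _) => [->|_]; rewrite ?orbF // orbT.
  by rewrite SE seenK -BE uB.
exists (rcons B (vars s xU)); split.
- by rewrite rcons_uniq UB uB.
- split; rewrite /= /upd /= ?size_rcons ?bB ?addn1 //.
  + move=> i lt_i; rewrite nth_rcons eqn_add2l.
    case: (ltngtP i (size B)) => [lt_iB|gt_iB|//]; first by rewrite nB.
    by move: lt_i; rewrite ltnS leqNgt gt_iB.
  + move=> i lt_i; case: eqP => [->|ne]; last by rewrite pB //; lia.
    by rewrite pB // expnS; lia.
- by move=> u; rewrite mem_rcons inE BE orbC orbA.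
- by move=> u; rewrite /= /upd /= orbA -SE; case: (u =P _); rewrite ?orbT ?orbF.
Qed.

Lemma run_collect t0 K s : base s -> vars s xT = t0.+1 -> alive ts t0 K ->
  has_bag K s -> (forall u, (arrs s aSeen u != 0) = seen ts t0 u) ->
  run collect s (100 * (size (bucket t0.+1 m)).+1)
    (fun s' => exists B, [/\ active ts t0.+1 B, has_bag B s'
       & forall u, (arrs s' aSeen u != 0) = seen ts t0.+1 u]).
Proof.
move=> bs sT aK bK sK; set L := bucket t0.+1 m.
pose A j u := has (fun i => u \in ends (edge i)) (take j L).
pose I j s := vars s xE = head_code (drop j L) /\ collected t0 K (A j) s.
eapply run_weaken with (Q := I (size L)).
- eapply run_seq with (Q1 := I 0).
    apply: run_straight => //; split.
      by have [_ _ _ _ [hd _ _ _]] := bs; rewrite /= /upd /= sT hd drop0.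
    exists K; split; [exact: aK.1 | exact: bK | |] => u; rewrite /A take0 orbF //.
    exact: sK.
  move=> s1 fr1 I1; have {}bs := base_frame fr1 isT bs.
  eapply run_while => //.
  + move=> j s2 lt_j fr [ej cj]; have {}bs := base_frame fr isT bs.
    have [hj bm et dj] := bucket_drop lt_j; set b := nth 0 L j in hj bm et dj.
    have bL : edge b \in ts by apply: mem_nth.
    split; first by rewrite /= ej hj.
    have [_ _ bU bV [_ bN _ _]] := bs.
    have endK u : u \in ends (edge b) -> seen ts t0 u = (u \in K).
      by move=> ub; rewrite aK.2 -[X in X <= _]et last_end ?andbT.
    pose C A' s' := vars s' xI = b /\ collected t0 K A' s'.
    eapply run_seq with (Q1 := fun s' => C (A j) s' /\ vars s' xU = (edge b).1.1).
      apply: run_straight => //; split; first split=> //.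
        by rewrite /= /upd /= ej hj subn1.
      by rewrite /= /upd /= ej hj subn1 bU.
    move=> s3 fr3 [[i3 c3] u3].
    eapply run_seq with (Q1 := C (fun u => A j u || (u == (edge b).1.1))).
      apply: run_straight => //; split; first by rewrite (effect_frame s3 _).1.
      by rewrite -u3; apply: collected_insert; rewrite // u3 endK // mem_head.
    move=> s4 fr4 [i4 c4].
    eapply run_seq with (Q1 := fun s' =>
      C (fun u => A j u || (u == (edge b).1.1)) s' /\ vars s' xU = (edge b).1.2).
      apply: run_straight => //; split=> //.
      by rewrite /= /upd /= fr4.2 // fr3.2 // bV i4.
    move=> s5 fr5 [[i5 c5] u5].
    eapply run_seq with
      (Q1 := C (fun u => (A j u || (u == (edge b).1.1)) || (u == (edge b).1.2))).
      apply: run_straight => //; split; first by rewrite (effect_frame s5 _).1.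
      by rewrite -u5; apply: collected_insert; rewrite // u5 endK // !inE eqxx orbT.
    move=> s6 fr6 [i6 [B [UB bB BE SE]]].
    apply: run_straight => //; split.
      rewrite /= /upd /= fr6.2 // fr5.2 // fr4.2 // fr3.2 // i6 bN //.
      by rewrite et dj.
    exists B; split=> // u; rewrite ?BE ?SE /A.
      by rewrite (take_nth 0) // has_rcons !inE -/b [in RHS](orbC (_ || _)) !orbA.
    by rewrite (take_nth 0) // has_rcons !inE -/b [in RHS](orbC (_ || _)) !orbA.
  + by move=> s2 _ [ej _]; rewrite /= ej drop_size.
- by rewrite /=; lia.
- move=> s' _ [_ [B [UB bB BE SE]]].
  have endL u : has (fun i => u \in ends (edge i)) L =
      has (fun x => (x.2 == t0.+1) && (u \in ends x)) ts.
    suff bucket_has i : i <= m -> has (fun i => u \in ends (edge i)) (bucket t0.+1 i) =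
        has (fun x => (x.2 == t0.+1) && (u \in ends x)) (take i ts).
      by rewrite bucket_has // take_size.
    elim: i => [|i IHi] im; first by rewrite take0.
    rewrite (take_nth (0,0,0)) // has_rcons /= -/(edge i) -(IHi (ltnW im)).
    by case: eqP.
  have seenS u : seen ts t0.+1 u =
      seen ts t0 u || has (fun i => u \in ends (edge i)) (take (size L) L).
    rewrite take_size endL /seen -has_predU; apply: eq_has => x /=.
    by case: (u \in ends x); rewrite ?andbF // !andbT; lia.
  exists B; split=> // [|u]; last by rewrite SE seenS.
  split=> // u; rewrite BE seenS aK.2 /A.
  case: (boolP (has _ _)) => [|_]; last first.
    by rewrite !orbF; case: (seen ts t0 u).
  rewrite take_size endL => /hasP[x xts /andP[/eqP xt ux]].
  by rewrite !orbT -xt last_end.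
Qed.

Lemma weight_rcons l u v : weight h (rcons l u) v =
  if v \in l then weight h l v else if v == u then h.+1 * 3 ^ size l else 0.
Proof.
rewrite /weight mem_rcons inE -cats1 index_cat; case: (boolP (v \in l)) => vl.
  by rewrite orbT.
by rewrite orbF /=; case: (v =P u) => // ->; rewrite eqxx addn0.
Qed.

Lemma run_layout t0 K B s : base s -> vars s xT = t0.+1 ->
  alive ts t0 K -> active ts t0.+1 B -> has_bag B s ->
  (forall u, arrs s aNew u = weight h K u) ->
  run layout s (100 * (size B).+1)
    (fun s' => exists N,
      [/\ alive ts t0.+1 N, has_bag B s',
          vars s' xB2 = size N /\
            (forall i, i < size N -> arrs s' aBag (vars s xO + size B + i) = nth 0 N i),
          {in B, forall u, arrs s' aOld u = weight h K u}
        & forall u, arrs s' aNew u = weight h N u]).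
Proof.
move=> bs sT aK aB [bB nB pB] wK.
pose N j := [seq u <- take j B | t0.+1 < last_time ts u].
pose I j s' := [/\ vars s' xI = j, vars s' xB2 = size (N j),
  (forall i, i < size B -> arrs s' aBag (vars s xO + i) = nth 0 B i),
  (forall i, i < size (N j) -> arrs s' aBag (vars s xO + size B + i) = nth 0 (N j) i)
  & {in take j B, forall u, arrs s' aOld u = weight h K u} /\
    forall u, arrs s' aNew u =
      if u \in take j B then weight h (N j) u else weight h K u].
eapply run_weaken with (Q := I (size B)).
- eapply run_seq with (Q1 := I 0).
    apply: run_straight => //; split; rewrite /N ?take0 //.
  move=> s1 fr1 I1; have {}bs := base_frame fr1 isT bs; have [fv1 fa1] := fr1.
  eapply run_while => //.
  + move=> j s2 lt_j fr [ij b2j oj nj [oldj newj]].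
    have {}bs := base_frame fr isT bs; have [fv fa] := fr.
    split; first by rewrite /= fv // fv1 // ij bB subn_eq0 -ltnNge.
    have [_ _ _ _ [_ _ bL _]] := bs.
    have [vO vB vT] : [/\ vars s2 xO = vars s xO, vars s2 xB = size B
        & vars s2 xT = t0.+1] by rewrite !fv // !fv1.
    have pE : arrs s2 aPow = arrs s aPow by rewrite fa // fa1.
    set u := nth 0 B j.
    have tk : take j.+1 B = rcons (take j B) u by rewrite (take_nth 0).
    have utk : u \notin take j B.
      by have := take_uniq j.+1 aB.1; rewrite tk rcons_uniq => /andP[].
    have szN : size (N j) <= size B.
      by rewrite size_filter (leq_trans (count_size _ _)) // size_take; case: ifP; lia.
    have Nj : N j.+1 = if t0.+1 < last_time ts u then rcons (N j) u else N j.
      by rewrite /N tk filter_rcons.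
    have uN : u \notin N j by rewrite mem_filter (negbTE utk) andbF.
    apply: run_straight => //.
    rewrite /I /= /upd /= ij vO vB vT bL (oj _ lt_j) -/u.
    case E: (last_time ts u - t0.+1) => [|c].
      have lu : (t0.+1 < last_time ts u) = false by lia.
      rewrite /= ?ij Nj lu; split; rewrite ?addn1 //.
      split=> v; rewrite tk ?mem_rcons ?inE.
        by case: (v =P u) => [->|_] /=; [rewrite newj (negbTE utk) | apply: oldj].
      case: (v =P u) => [->|_] /=; last by rewrite newj.
      by rewrite /weight (negbTE uN).
    have lu : (t0.+1 < last_time ts u) = true by lia.
    rewrite /= ?ij ?vO ?vB Nj lu; split=> //; rewrite ?size_rcons ?b2j ?addn1 //.
    (* The next bag is written behind the current one and cannot overwrite it. *)
    * by move=> i lt_i; rewrite ifN ?oj // -addnA eqn_add2l; lia.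
    * move=> i lt_i; rewrite eqn_add2l nth_rcons.
      case: (ltngtP i (size (N j))) => [lt_iN|gt_iN|//]; first by rewrite nj.
      by move: lt_i; rewrite ltnS leqNgt gt_iN.
    * split=> v; rewrite tk ?mem_rcons ?inE.
        by case: (v =P u) => [->|_] /=; [rewrite newj (negbTE utk) | apply: oldj].
      rewrite weight_rcons; case: (v =P u) => [->|_] /=.
        by rewrite (negbTE uN) pE pB.
      by rewrite newj; case: ifP => // _; case: ifP => // vN; rewrite /weight vN.
  + move=> s2 [fv fa] [ij _ _ _ _].
    by rewrite /= fv // fv1 // ij bB subnn.
- by rewrite /=; lia.
- move=> s' [fv fa]; rewrite /I /N take_size => - [_ b2 oB nN [old new]].
  set N' := filter _ B in b2 nN new.
  have NB u : (u \in N') = seen ts t0.+1 u && (t0.+1 < last_time ts u).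
    rewrite mem_filter aB.2; case: (seen ts t0.+1 u); rewrite ?andbF //=.
    by lia.
  exists N'; split=> //.
  + by split=> //; rewrite filter_uniq // aB.1.
  + split; first by rewrite fv.
      by move=> i; rewrite fv //; apply: oB.
    by move=> i; rewrite fa //; apply: pB.
  (* Outside [B] the old weight stays in place, and it is [0] like the new one because [K] and [N']
     lie in [B]. *)
  + move=> u; rewrite new; case: ifP => // uB.
    rewrite /weight mem_filter uB andbF ifF //; apply: contraFF uB => uK.
    exact: alive_active aK aB _ uK.
Qed.

Definition ready (t0 : nat) (K B N : seq nat) (s : state) : Prop :=
  [/\ base s, vars s xT = t0.+1, has_bag B s,
      {in B, forall u, arrs s aOld u = weight h K u}
    & forall u, arrs s aNew u = weight h N u].

Definition keeps_ready (c : cmd) : bool :=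
  [&& keeps_base c, all (fun x => x \notin mod_vars c) [:: xT; xB; xO]
    & all (fun a => a \notin mod_arrs c) [:: aBag; aPow; aOld; aNew]].

Lemma ready_frame c s s' t0 K B N : frame c s s' -> keeps_ready c ->
  ready t0 K B N s -> ready t0 K B N s'.
Proof.
move=> fr /and3P[kb /allP kv /allP ka] [bs sT [bB nB pB] old new].
have [fv fa] := fr; split; rewrite ?(fv _ (kv _ _)) ?(fa _ (ka _ _)) //.
  exact: base_frame fr kb bs.
by split; rewrite ?(fv _ (kv _ _)) ?(fa _ (ka _ _)).
Qed.

(** This splits off the leading base 3 digit: the loop of [decode] holds the remainder of [Q] modulo
    decreasing powers. *)
Lemma modn_expS Q i : Q %% 3 ^ i.+1 = (Q %/ 3 ^ i) %% 3 * 3 ^ i + Q %% 3 ^ i.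
Proof.
have p0 : 0 < 3 ^ i by rewrite expn_gt0.
rewrite {1}(divn_eq Q (3 ^ i)) {1}(divn_eq (Q %/ 3 ^ i) 3) mulnDl -mulnA -expnS.
rewrite -addnA modnMDl modn_small // expnS.
have := ltn_pmod Q p0; have : (Q %/ 3 ^ i) %% 3 < 3 by rewrite ltn_mod.
by nia.
Qed.

Lemma leading_test1 a p r : r < p -> (a * p + r + 1 - p != 0) = (0 < a).
Proof. by case: a => [|a]; rewrite ?mulSn; lia. Qed.

Lemma leading_test2 a p r : r < p -> 0 < a ->
  (a * p + r - p + 1 - p != 0) = (1 < a).
Proof. by case: a => [|[|a]]; rewrite ?mulSn; lia. Qed.

Lemma leading_rem1 p r : 1 * p + r - p = r.
Proof. by rewrite mul1n addKn. Qed.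

Lemma leading_rem2 p r : 2 * p + r - p - p = r.
Proof. by rewrite mul2n -addnn -addnA !addKn. Qed.

(** * One sweep over all placements *)

Section Pass.
Variables (t0 : nat) (K B N : seq nat).
Hypotheses (aliveK : alive ts t0 K) (activeB : active ts t0.+1 B)
  (aliveN : alive ts t0.+1 N).

Definition decoded (d : nat -> nat) (l : seq nat) (off off2 : nat) (s : state) : Prop :=
  [/\ {in l, forall u, arrs s aDig u = d u},
      vars s xSrc = off + \sum_(u <- l | d u == 2) weight h K u,
      vars s xDst = off2 + \sum_(u <- l | 0 < d u) weight h N u,
      vars s xNew = fresh l d
    & vars s xCost = if bad ss K l d then k.+1 else 0].

Lemma run_decode Q s : ready t0 K B N s -> vars s xQ = h.+1 * Q ->
  Q < 3 ^ size B ->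
  run decode s (200 * (size B).+1)
    (decoded (digit B Q) B (vars s xOff) (vars s xOff2)).
Proof.
move=> rs sQ lt_Q; set d := digit B Q.
pose l j := drop (size B - j) B.
pose I j s' := [/\ vars s' xI = size B - j,
  vars s' xRem = h.+1 * (Q %% 3 ^ (size B - j))
  & decoded d (l j) (vars s xOff) (vars s xOff2) s'].
eapply run_weaken with (Q := I (size B)).
- eapply run_seq with (Q1 := I 0).
    apply: run_straight => //; have [_ _ [bB _ _] _ _] := rs.
    rewrite /I /decoded /l !subn0 drop_size /= /upd /= bB sQ modn_small //.
    by split=> //; rewrite !big_nil !addn0.
  move=> s1 fr1 I1; have {}rs := ready_frame fr1 isT rs.
  eapply run_while => //.
  + move=> j s2 lt_j fr2 [ij remj [digj srcj dstj newj costj]].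
    have {rs} [bs _ [bB nB pB] old new] := ready_frame fr2 isT rs.
    set i := (size B - j.+1).
    have iE : size B - j = i.+1 by rewrite /i; lia.
    have lt_i : i < size B by lia.
    split; first by rewrite /= ij iE.
    have lj : l j = drop i.+1 B by rewrite /l iE.
    have ljS : l j.+1 = nth 0 B i :: l j by rewrite lj -drop_nth.
    set u := nth 0 B i in ljS.
    have uB : u \in B by apply: mem_nth.
    have du : d u = (Q %/ 3 ^ i) %% 3 by rewrite /d /digit index_uniq // activeB.1.
    have d3 : d u < 3 by apply: digit_lt3.
    have [bK _ _ _ [_ _ _ bI]] := bs.
    set p := h.+1 * 3 ^ i; set r0 := h.+1 * (Q %% 3 ^ i).
    have rp : r0 < p by rewrite ltn_pmul2l // ltn_mod expn_gt0.
    have remE : vars s2 xRem = d u * p + r0.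
      by rewrite remj iE modn_expS -du /p /r0; lia.
    have pi : arrs s2 aPow i = p by rewrite pB // ltnW.
    have ui : arrs s2 aBag (vars s2 xO + i) = u by rewrite nB.
    have decodedS s' c : vars s' xI = i -> vars s' xRem = r0 ->
        arrs s' aDig = upd (arrs s2 aDig) u c -> c = d u ->
        vars s' xSrc = vars s2 xSrc + (if d u == 2 then weight h K u else 0) ->
        vars s' xDst = vars s2 xDst + (if 0 < d u then weight h N u else 0) ->
        vars s' xNew = vars s2 xNew + (d u == 1) ->
        vars s' xCost = (if (if d u == 2 then (u \notin K) && (u \notin ss)
                             else u \in ss) then k.+1 else vars s2 xCost) ->
        I j.+1 s'.
      move=> i' r' dig' cE src' dst' new' cost'; split=> //.
      rewrite /decoded ljS !big_cons /fresh /bad /=.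
      rewrite -/(bad ss K (l j) d) -/(fresh (l j) d).
      split.
      - move=> v; rewrite inE dig' cE /upd; case: (v =P u) => [->|_] //=; exact: digj.
      - by rewrite src' srcj; case: ifP => _; rewrite ?addn0 // addnAC -addnA.
      - by rewrite dst' dstj; case: ifP => _; rewrite ?addn0 // addnAC -addnA.
      - by rewrite new' newj addnC.
      - by rewrite cost' costj; case: (if d u == 2 then _ else _).
    eapply run_seq with (Q1 := fun s' => vars s' xI = i /\ vars s' xU = u).
      by apply: run_straight => //; rewrite /= /upd /= ij iE subn1 ui.
    move=> s3 [fv3 fa3] [i3 u3].
    (* Vertices of [K] have positive weight, so testing one sum checks for membership in [K] and in
       the sources together. *)
    have nKs : (u \notin K) && (u \notin ss) = (weight h K u + (u \in ss) == 0).
      rewrite /weight; case: (u \in K); case: (u \in ss); rewrite ?addn0 ?addn1 //=.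
      by rewrite muln_eq0 expn_eq0.
    apply: run_if; rewrite /= fv3 // fa3 // remE i3 pi => test.
    + have d1 : 0 < d u by rewrite -(leading_test1 _ rp).
      eapply run_seq with (Q1 := fun s' => vars s' xRem = vars s2 xRem - p /\
          vars s' xDst = vars s2 xDst + weight h N u).
        apply: run_straight => //=.
        by rewrite /upd /= i3 u3 !fv3 // !fa3 // pi new.
      move=> s4 [fv4 fa4] [rem4 dst4].
      have [i4 u4] : vars s4 xI = i /\ vars s4 xU = u by rewrite !fv4.
      have [f4 _] := frame_seq (conj fv3 fa3) (conj fv4 fa4).
      have a4 : arrs s4 = arrs s2.
        by apply: functional_extensionality => a; rewrite fa4 ?fa3.
      apply: run_if; rewrite /= rem4 remE i4 a4 pi => test2.
      * have E : d u = 2.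
          by move: test2; rewrite leading_test2 //; case: (d u) d3 d1 => [|[|[|]]].
        apply: run_straight => //=.
        rewrite /upd /= u4 a4 bI old //.
        case E2 : (weight h K u + _) => [|c]; apply: (@decodedS _ 2);
          rewrite /= /upd ?E //= ?rem4 ?remE ?i4 ?a4 ?u4 ?pi ?f4 ?old
            ?dst4 ?bK ?E ?leading_rem2 ?nKs ?E2 ?addn1 ?addn0 //.
      * have E : d u = 1.
          by have := leading_test2 rp d1; rewrite test2; case: (d u) d1 => [|[|]].
        apply: run_straight => //=.
        rewrite /upd /= u4 a4 bI.
        case E2 : (u \in ss); apply: (@decodedS _ 1);
          rewrite /= /upd ?E //= ?rem4 ?remE ?i4 ?a4 ?u4 ?pi ?f4 ?E2
            ?dst4 ?bK ?E ?leading_rem1 ?addn1 ?addn0 //.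
    + have E : d u = 0.
        by have := leading_test1 (d u) rp; rewrite test; case: (d u).
      apply: run_straight => //=.
      have a3 : arrs s3 = arrs s2 by apply: functional_extensionality => a; rewrite fa3.
      rewrite /upd /= u3 a3 bI.
      case E2 : (u \in ss); apply: (@decodedS _ 0);
          rewrite /= /upd ?E //= ?i3 ?a3 ?u3 ?fv3 // ?remE ?E2 ?bK
            ?E ?mul0n ?add0n ?addn1 ?addn0 //.
  + by move=> s2 _ [ij _ _]; rewrite /= ij subnn.
- by rewrite /=; lia.
- by move=> s' _ [_ _]; rewrite /l subnn drop0.
Qed.

Lemma run_add_charge d s : ready t0 K B N s -> {in B, forall u, arrs s aDig u = d u} ->
  run add_charge s (100 * (size (bucket t0.+1 m)).+1)
    (fun s' => vars s' xCost =
       vars s xCost + \sum_(x <- ts | x.2 == t0.+1) viol d x).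
Proof.
move=> rs digs; set L := bucket t0.+1 m.
pose I j s' := vars s' xE = head_code (drop j L) /\
  vars s' xCost = vars s xCost + \sum_(i <- take j L) viol d (edge i).
eapply run_weaken with (Q := I (size L)).
- eapply run_seq with (Q1 := I 0).
    have [[_ _ _ _ [hd _ _ _]] sT _ _ _] := rs.
    by apply: run_straight => //; rewrite /I /= /upd /= sT hd drop0 take0 big_nil addn0.
  move=> s1 fr1 I1; have {}rs := ready_frame fr1 isT rs.
  eapply run_while => //.
  + move=> j s2 lt_j fr [ej cj].
    have {rs} [bs _ _ _ _] := ready_frame fr isT rs.
    have [hj bm et dj] := bucket_drop lt_j; set b := nth 0 L j in hj bm et dj.
    have bL : edge b \in ts by apply: mem_nth.
    split; first by rewrite /= ej hj.
    have [_ _ bU bV [_ bN _ _]] := bs.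
    have dig : arrs s2 aDig = arrs s aDig by rewrite fr.2 // fr1.2.
    (* [aDig] may hold stale digits of vertices that left the bag, but endpoints at the current time
       are in [B]. *)
    have endB u : u \in ends (edge b) -> arrs s aDig u = d u.
      by move=> ub; apply/digs/(end_active activeB bL).
    apply: run_straight => //; rewrite /I /= /upd /= ej hj subn1 bU bV bN // et dj.
    split=> //; rewrite cj dig !endB ?mem_head ?inE ?eqxx ?orbT //.
    by rewrite (take_nth 0) // big_rcons /= -addnA.
  + by move=> s2 _ [ej _]; rewrite /= ej drop_size.
- by rewrite /=; lia.
- move=> s' _ [_ ->]; congr (_ + _).
  by rewrite take_size sum_bucket // take_size.
Qed.

Definition relaxed_by (T T' : nat -> nat) (src dst nw cost : nat) : Prop :=
  forall x, T' x = if dst + nw <= x <= dst + h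
                   then maxn (T x) (T (src + (x - (dst + nw))) - cost) else T x.

(** The second hypothesis puts the cells read below the cells written, so updating in place never
    reads a modified entry as a source. *)
Lemma run_relax s : vars s xH = h -> vars s xSrc + h < vars s xDst ->
  run relax s (100 * h.+2)
    (fun s' => relaxed_by (arrs s aTab) (arrs s' aTab)
       (vars s xSrc) (vars s xDst) (vars s xNew) (vars s xCost)).
Proof.
set T := arrs s aTab; set src := vars s xSrc; set dst := vars s xDst.
set nw := vars s xNew; set cost := vars s xCost => sH sd.
pose I j s' := vars s' xR = j /\ forall x, arrs s' aTab x =
  if (dst + nw <= x) && (x < dst + nw + j)
  then maxn (T x) (T (src + (x - (dst + nw))) - cost) else T x.
eapply run_weaken with (Q := I (h.+1 - nw)).
- eapply run_seq with (Q1 := I 0).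
    apply: run_straight => //; split=> // x; rewrite /= addn0.
    by case: leqP => //= ge; rewrite ltnNge ge.
  move=> s1 fr1 I1; eapply run_while => //.
  + move=> j s2 lt_j fr2 [rj tj].
    have [f _] := frame_seq fr1 fr2.
    split; first by rewrite /= rj !f // sH -/nw; lia.
    apply: run_straight => //; split; first by rewrite /= /upd /= rj addn1.
    move=> x; rewrite /= /upd /= rj !f // -/src -/dst -/nw -/cost !tj.
    rewrite (_ : (_ <= src + j) && _ = false); last by lia.
    rewrite (_ : (_ <= dst + nw + j) && _ = false); last by lia.
    case: (x =P dst + nw + j) => [->|ne].
      rewrite (_ : (_ <= _) && _ = true) ?addKn; last by lia.
      by lia.
    by rewrite (_ : (x < dst + nw + j.+1) = (x < dst + nw + j)) //; lia.
  + move=> s2 fr2 [rj _].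
    by rewrite /= rj !fr2.1 // !fr1.1 // sH -/nw; lia.
- by rewrite /=; lia.
- move=> s' _ [_ E] x; rewrite E.
  by rewrite (_ : (_ <= x) && _ = (dst + nw <= x <= dst + h)) //; lia.
Qed.

(** [K] is contained in [B], so the current table fits into the [h.+1 * 3 ^ size B] cells that
    [sweep] reserves for it. *)
Lemma src_lt d : src h K d + h < h.+1 * 3 ^ size B.
Proof.
have KB := alive_active aliveK activeB.
rewrite /src -(sum_weight _ _ aliveK.1 activeB.1 KB).
apply: leq_trans (sum_weight_lt _ aliveK.1 activeB.1 KB (leqnn h)) _.
by rewrite leq_mul2l /= leq_pexp2l // uniq_leq_size // aliveK.1.
Qed.

Lemma dst_lt d : dst h N d + h < h.+1 * 3 ^ size N.
Proof.
have NB := alive_active_next activeB aliveN.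
rewrite /dst -(sum_weight _ _ aliveN.1 activeB.1 NB).
exact: sum_weight_lt aliveN.1 activeB.1 NB (leqnn h).
Qed.

Lemma run_pass Q s : ready t0 K B N s -> vars s xQ = h.+1 * Q ->
  Q < 3 ^ size B -> vars s xOff2 = vars s xOff + h.+1 * 3 ^ size B ->
  let d := digit B Q in
  run pass s (200 * (size B + size (bucket t0.+1 m) + h + 4))
    (fun s' => relaxed_by (arrs s aTab) (arrs s' aTab)
       (vars s xOff + src h K d) (vars s xOff2 + dst h N d) (fresh B d)
       (charge k ss ts t0 K B d)).
Proof.
move=> rs sQ lt_Q sO d.
have KB := alive_active aliveK activeB; have NB := alive_active_next activeB aliveN.
have srcE : \sum_(u <- B | d u == 2) weight h K u = src h K d.
  by rewrite sum_weight ?aliveK.1 ?activeB.1.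
have dstE : \sum_(u <- B | 0 < d u) weight h N u = dst h N d.
  by rewrite sum_weight ?aliveN.1 ?activeB.1.
have lt_src := src_lt d.
match goal with |- run _ _ _ ?R => eapply run_weaken with (Q := R) end.
- eapply run_seq; first exact: run_decode rs sQ lt_Q.
  move=> s1 fr1 [dig1 src1 dst1 new1 cost1].
  have rs1 := ready_frame fr1 isT rs.
  eapply run_seq; first exact: run_add_charge rs1 dig1.
  move=> s2 fr2 cost2; have [[_ sH _ _ _] _ _ _ _] := ready_frame fr2 isT rs1.
  have -> : vars s xOff + src h K d = vars s2 xSrc by rewrite fr2.1 // src1 srcE.
  have -> : vars s xOff2 + dst h N d = vars s2 xDst by rewrite fr2.1 // dst1 dstE.
  have -> : fresh B d = vars s2 xNew by rewrite fr2.1.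
  have -> : charge k ss ts t0 K B d = vars s2 xCost by rewrite cost2 cost1.
  have -> : arrs s aTab = arrs s2 aTab by rewrite fr2.2 // fr1.2.
  apply: run_relax => //.
  by rewrite !fr2.1 // src1 dst1 sO srcE dstE -addnA; move: lt_src; lia.
- by lia.
- by [].
Qed.

(** The loop invariant behind [relaxed]: the lower bound holds so far for placements below [j] only,
    and the old table is intact. *)
Definition swept (T0 : nat -> nat) (off off2 j : nat) (T : nat -> nat) : Prop :=
  [/\ forall x, x < off2 -> T x = T0 x,
  forall q r, let d := digit B q in q < j -> r + fresh B d <= h ->
     T0 (off + (src h K d + r)) - charge k ss ts t0 K B d
       <= T (off2 + (dst h N d + (r + fresh B d)))
  & forall x, 0 < T (off2 + x) -> exists q r, let d := digit B q in
     [/\ r + fresh B d <= h, x = dst h N d + (r + fresh B d)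
       & T (off2 + x) <= T0 (off + (src h K d + r)) - charge k ss ts t0 K B d]].

Lemma swept_step T0 T T' off off2 j : let d := digit B j in
  off + (src h K d + h) < off2 ->
  relaxed_by T T' (off + src h K d) (off2 + dst h N d) (fresh B d)
    (charge k ss ts t0 K B d) ->
  swept T0 off off2 j T -> swept T0 off off2 j.+1 T'.
Proof.
move=> d src_lt rel [low comp sound].
have relT0 r : r <= h -> T (off + src h K d + r) = T0 (off + (src h K d + r)).
  by move=> rh; rewrite -addnA low //; move: src_lt; lia.
have mono x : T x <= T' x by rewrite rel; case: ifP => _ //; rewrite leq_maxl.
split.
- by move=> x lt_x; rewrite rel ifF ?low //; apply/negbTE; lia.
- move=> q r /=; rewrite ltnS leq_eqVlt => /predU1P[->|lt_q] rh; last first.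
    by apply: leq_trans (comp q r lt_q rh) (mono _).
  rewrite -/d in rh *; rewrite rel ifT; last by lia.
  rewrite leq_max -relT0; last by lia.
  by rewrite (_ : _ - (_ + fresh B d) = r) ?leqnn ?orbT //; lia.
- move=> x; rewrite rel; case: ifP => [/andP[ge le]|_]; last exact: sound.
  case: (leqP (T (off2 + x)) _) => _ Tx; last exact: sound _ Tx.
  (* The entry takes its value from the present pass, so the current placement is the witness and
     the offset gives the count. *)
  exists j, (off2 + x - (off2 + dst h N d + fresh B d)); rewrite -/d; split.
  + by lia.
  + by lia.
  + by rewrite relT0 //; lia.
Qed.

Lemma run_sweep s : ready t0 K B N s ->
  let T0 := arrs s aTab in
  (forall x, vars s xOff + h.+1 * 3 ^ size K <= x -> T0 x = 0) ->
  run sweep s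
    (3 ^ size B * (200 * (size B + size (bucket t0.+1 m) + h + 4) + 20) + 20)
    (fun s' => [/\ vars s' xOff2 = vars s xOff + h.+1 * 3 ^ size B,
       relaxed k h ss ts t0 K B N T0 (vars s xOff) (arrs s' aTab) (vars s' xOff2)
     & forall x, vars s' xOff2 + h.+1 * 3 ^ size N <= x -> arrs s' aTab x = 0]).
Proof.
move=> rs T0 T00; set off := vars s xOff.
set off2 := off + h.+1 * 3 ^ size B.
have KB := alive_active aliveK activeB.
pose I j s' := [/\ vars s' xQ = h.+1 * j, vars s' xOff2 = off2
  & swept T0 off off2 j (arrs s' aTab)].
eapply run_weaken with (Q := I (3 ^ size B)).
- eapply run_seq with (Q1 := I 0).
    have [_ _ [bB _ pB] _ _] := rs; apply: run_straight => //.
    rewrite /I /= /upd /= muln0 bB pB //; split=> //; split=> // x; rewrite -/T0 T00 //.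
    rewrite /off2 -addnA leq_add2l; apply: leq_trans _ (leq_addr _ _).
    by rewrite leq_mul2l /= leq_pexp2l // uniq_leq_size // aliveK.1.
  move=> s1 fr1 I1; have {}rs := ready_frame fr1 isT rs.
  have offE : vars s1 xOff = off by rewrite fr1.1.
  eapply run_while => //.
  + move=> j s2 lt_j fr2 [qj oj swj].
    have {}rs := ready_frame fr2 isT rs; have [_ _ [bB _ pB] _ _] := rs.
    split; first by rewrite /= bB pB // qj subn_eq0 -ltnNge ltn_pmul2l.
    have off2E : vars s2 xOff = off by rewrite fr2.1.
    eapply run_seq.
      by apply: run_pass rs qj lt_j _; rewrite oj off2E.
    rewrite off2E oj => s3 fr3 rel.
    have [_ _ [_ _ pB3] _ _] := ready_frame fr3 isT rs.
    apply: run_straight => //; split.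
    * by rewrite /= /upd /= fr3.1 // qj pB3 // expn0 muln1 mulnS addnC.
    * by rewrite /= /upd /= fr3.1.
    * by apply: swept_step rel swj; rewrite /off2 ltn_add2l src_lt.
  + move=> s2 fr2 [qj _ _].
    have [_ _ [bB _ pB] _ _] := ready_frame fr2 isT rs.
    by rewrite /= bB pB // qj subnn.
- by rewrite /=; lia.
- move=> s' _ [_ o [low comp sound]]; rewrite o; split=> // x le_x.
  (* A positive cell past the new table would be the target of some placement, which [dst_lt]
     excludes; so the cells of the next table are still zero. *)
  have [lt|ge] := ltnP x off2; first by lia.
  rewrite -(subnKC ge); apply/eqP; rewrite -leqn0 leqNgt; apply/negP.
  case/sound=> q [r /= [rh xE _]].
  by have := dst_lt (digit B q); lia.
Qed.

End Pass.

Definition processed (t : nat) (s : state) : Prop :=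
  [/\ base s, vars s xT = t & exists K, [/\ alive ts t K, has_bag K s,
    forall u, (arrs s aSeen u != 0) = seen ts t u,
    forall u, arrs s aNew u = weight h K u
    & table_ok k h ss ts t K (arrs s aTab) (vars s xOff) /\
      (forall x, vars s xOff + h.+1 * 3 ^ size K <= x -> arrs s aTab x = 0)]].

Variables w e : nat.
Hypothesis width_le : forall t B, active ts t B -> size B <= w.
Hypothesis bucket_le : forall t, size (bucket t m) <= e.

(** The [3 ^ w] placements dominate; [e] bounds the simultaneous time-edges and is later taken to be
    the square of the width. *)
Lemma run_step t0 s : t0 < max_time ts -> processed t0 s ->
  run step s (3 ^ w * (400 * (w + e + h + 4))) (processed t0.+1).
Proof.
move=> lt_t0 [bs sT [K [aK bK sK nK [okK zK]]]].
eapply run_weaken with (Q := processed t0.+1); last by [].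
  eapply run_seq with (Q1 := fun s' => vars s' xT = t0.+1).
    by apply: run_straight => //; rewrite /= /upd /= sT addn1.
  move=> s1 fr1 t1; have bs1 := base_frame fr1 isT bs.
  eapply run_seq with (t1 := 100 * e.+1).
    eapply run_weaken; first apply: run_collect bs1 t1 aK _ _.
    - by case: bK => *; split; rewrite ?fr1.1 ?fr1.2.
    - by move=> u; rewrite fr1.2 // sK.
    - by rewrite leq_mul2l /= ltnS bucket_le.
    - by move=> s' _ Q; exact: Q.
  move=> s2 fr2 [B [aB bB sB]]; have bs2 := base_frame fr2 isT bs1.
  have szB := width_le aB; have szE := bucket_le t0.+1.
  have t2 : vars s2 xT = t0.+1 by rewrite fr2.1.
  eapply run_seq with (t1 := 100 * w.+1).
    eapply run_weaken; first apply: run_layout bs2 t2 aK aB bB _.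
    - by move=> u; rewrite fr2.2 // fr1.2 // nK.
    - by rewrite leq_mul2l /= ltnS; exact: szB.
    - by move=> s' _ Q; exact: Q.
  move=> s3 fr3 [N [aN bB3 [b2N nN] old3 new3]].
  have bs3 := base_frame fr3 isT bs2.
  have rs3 : ready t0 K B N s3 by split=> //; rewrite fr3.1.
  have tab3 : arrs s3 aTab = arrs s aTab by rewrite fr3.2 // fr2.2 // fr1.2.
  have off3 : vars s3 xOff = vars s xOff by rewrite fr3.1 // fr2.1 // fr1.1.
  eapply run_seq with (t1 := 3 ^ w * (200 * (w + e + h + 4) + 20) + 20).
    eapply run_weaken; first apply: (run_sweep aK aB aN rs3).
    - by move=> x; rewrite tab3 off3; apply: zK.
    - rewrite leq_add2r leq_mul ?leq_pexp2l // leq_add2r leq_mul2l /=.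
      by rewrite !leq_add.
    - by move=> s' _ Q; exact: Q.
  move=> s4 fr4 [o4 rel4 z4].
  have [bs4 t4 [bB4 nB4 pB4] _ new4] := ready_frame fr4 isT rs3.
  apply: run_straight => //; split; first exact: (base_frame (effect_frame s4 _) _ bs4).
    by rewrite /= /upd /=.
  exists N; split=> //.
  - split; rewrite /= /upd /=.
    + by rewrite fr4.1.
    + move=> i lt_i; rewrite bB4 fr4.1 // fr4.2 // fr3.1 //.
      exact: nN.
    + move=> i lt_i; apply: pB4; apply: leq_trans lt_i _.
      apply: uniq_leq_size aN.1 _ => u; exact: alive_active_next aB aN _.
  - by move=> u; rewrite /= fr4.2 // fr3.2.
  - split=> //; rewrite /= /upd /=.
    apply: table_step aK aB aN lt_t0 okK _.
    by rewrite -tab3 -off3.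
have : 0 < 3 ^ w by rewrite expn_gt0.
by rewrite /=; nia.
Qed.

Lemma run_finish s : vars s xH = h ->
  run finish s (50 * h.+2) (fun s' => accepts s' <->
    exists2 r, r <= h & 0 < arrs s aTab (vars s xOff + r)).
Proof.
move=> sH; set T := arrs s aTab; set off := vars s xOff.
pose I j s' := vars s' xR = j /\ vars s' xRes = \sum_(0 <= r < j) T (off + r).
eapply run_weaken with (Q := I h.+1).
- eapply run_seq with (Q1 := I 0).
    by apply: run_straight => //; split=> //=; rewrite big_geq.
  move=> s1 fr1 I1; eapply run_while => //.
  + move=> j s2 lt_j fr2 [rj xj].
    split.
      by rewrite /= rj fr2.1 // fr1.1 // sH addn1 subn_eq0 -ltnNge.
    apply: run_straight => //; split; rewrite /= /upd /= rj ?addn1 //.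
    by rewrite xj fr2.2 // fr1.2 // fr2.1 // fr1.1 // big_nat_recr.
  + by move=> s2 fr2 [rj _]; rewrite /= rj fr2.1 // fr1.1 // sH addn1 subnn.
- by rewrite /=; lia.
- move=> s' _ [_ xE]; rewrite /accepts xE big_mkord sum_nat_eq0 negb_forall.
  split=> [/existsP[r]|[r rh Tr]]; last apply/existsP.
    by rewrite /= -lt0n => Tr; exists r => //; rewrite -ltnS ltn_ord.
  have rh' : r < h.+1 by [].
  by exists (Ordinal rh'); rewrite /= -lt0n.
Qed.

Lemma run_body s :
  vars s xK = k -> vars s xH = h -> vars s xS = size ss -> vars s xM = m ->
  (forall x, 5 < x -> vars s x = 0) ->
  arrs s aS = nth 0 ss -> arrs s aU = (fun i => (edge i).1.1) ->
  arrs s aV = (fun i => (edge i).1.2) -> arrs s aTime = (fun i => (edge i).2) ->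
  (forall a, 5 < a -> arrs s a = (fun=> 0)) ->
  run body s
    (100 * (m + h + 2) + max_time ts * (3 ^ w * (400 * (w + e + h + 4)) + 10)
     + 50 * h.+2)
    (fun s' => accepts s' <-> exists f, [/\ spread ss ts f,
       infected ss ts (max_time ts) f <= h & deletions ts (max_time ts) f <= k]).
Proof.
move=> sK sH sS sM v0 sA sU sV sTm a0.
set X := max_time ts * _.
match goal with |- run _ _ _ ?R => eapply run_weaken with (Q := R); last by [] end.
  eapply run_seq; first by apply: run_mark => //; rewrite a0.
  move=> s1 fr1 ins1.
  eapply run_seq.
    by apply: run_sort; rewrite ?fr1.1 ?fr1.2 // ?v0 ?a0.
  move=> s2 fr2 [hd2 nx2 la2 mx2]; rewrite !take_size in la2 mx2.
  have mxE : vars s2 xLam = max_time ts by [].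
  eapply run_seq with (Q1 := processed 0).
    have [v2 a2] := frame_seq fr1 fr2.
    apply: run_straight => //.
    split=> //=.
    - split; [by rewrite /= /upd /= v2 | by rewrite /= /upd /= v2
        | by rewrite /= /upd /= a2 | by rewrite /= /upd /= a2
        | rewrite /= /upd /=; split=> //].
      + by apply: functional_extensionality => t; rewrite hd2.
      + by apply: functional_extensionality => u; rewrite la2.
      + by rewrite fr2.2.
    - exists [::]; split.
      + exact: alive0.
      + split; rewrite /= /upd /= //; first by rewrite v2 // v0.
        by case=> // _; rewrite v2 // sH expn0 muln1 addn1.
      + by move=> u; rewrite /= /upd /= a2 // a0 //= (negbTE (seen0 ts_pos u)).
      + by move=> u; rewrite /= /upd /= a2 // a0.
      + have tabE x : (if x == vars s2 xS then vars s2 xK + 1 else arrs s2 aTab x)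
            = if x == size ss then k.+1 else 0.
          by rewrite !v2 // sS sK a2 // a0 // addn1.
        have offE : vars s2 xOff = 0 by rewrite v2 // v0.
        rewrite /= /upd /= offE; split.
          by apply: table_init => // x; apply: tabE.
        move=> x; rewrite expn0 muln1 add0n => lt_x; rewrite tabE ifF //.
        by apply/negbTE; rewrite neq_ltn (leq_ltn_trans ss_h lt_x) orbT.
  move=> s3 fr3 I3.
  eapply run_seq with (Q1 := processed (max_time ts)).
    eapply run_while with (I := processed) (N := max_time ts) => //.
    - move=> j s4 lt_j fr4 pj; split; last exact: run_step.
      have [_ tj _] := pj.
      by rewrite /= tj fr4.1 // fr3.1 // mxE subn_eq0 -ltnNge.
    - move=> s4 fr4 [_ tj _].
      by rewrite /= tj fr4.1 // fr3.1 // mxE subnn.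
  move=> s4 fr4 [bs4 _ [K4 [aK4 _ _ _ [ok4 _]]]].
  have K0 := alive_max aK4; rewrite K0 in ok4.
  eapply run_weaken; first by apply: run_finish; case: bs4.
    exact: leqnn.
  by move=> s' _ ->; apply: table_final ok4.
by rewrite /=; move: ss_h; lia.
Qed.

End Program.

(** * Infection times in temporal graphs *)

Lemma mem_time_edges (V : finType) (G : tgraph V) e t :
  ((e, t) \in time_edges G) = (t \in tau G e).
Proof.
apply/allpairsPdep/idP => [[e' [t' [_ te' [-> ->]]]] //|te].
exists e, t; split=> //; rewrite mem_enum; apply: contraTT te => /tau_edges ->.
by rewrite in_fset0.
Qed.

Lemma time_edges_uniq (V : finType) (G : tgraph V) : uniq (time_edges G).
Proof.
apply: allpairs_uniq_dep; first exact: enum_uniq.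
  by move=> e _; apply: fset_uniq.
by move=> [e t] [e' t'] _ _ /= [-> ->].
Qed.

Lemma lifetime_ge (V : finType) (G : tgraph V) e t : t \in tau G e -> t <= lifetime G.
Proof.
move=> te; have eG : e \in edges G.
  by apply: contraTT te => /tau_edges ->; rewrite in_fset0.
apply: leq_trans (leq_bigmax_cond (F := fun e => \max_(t <- tau G e) t) _ eG).
exact: (leq_bigmax_seq (F := id)).
Qed.

(** Outside the range of the maximum, [F_t] is empty. *)
Lemma vim_set_le (V : finType) (G : tgraph V) t : #|vim_set G t| <= vimw G.
Proof.
have [->|[v]] := set_0Vmem (vim_set G t); first by rewrite cards0.
rewrite inE => /asboolP[i [j [u [w [it tj iu jw]]]]].
apply: (leq_bigmax_seq (F := fun t => #|vim_set G t|)) => //.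
rewrite mem_index_iota ltnS (leq_trans tj (lifetime_ge jw)) andbT.
apply: leq_trans it; rewrite lt0n.
by apply: contraTneq iu => ->; apply: tau_pos.
Qed.

(** Times are positive, so every temporal walk may be regarded as departing at time [0], which gives
    inductions a current time to carry. *)
Lemma walk_path0 (V : finType) (G : tgraph V) v p :
  is_walk G v p -> sorted ltn (unzip2 p) -> path ltn 0 (unzip2 p).
Proof.
case: p => [|[x t] p] //= /andP[te _] ->; rewrite andbT lt0n.
by apply: contraTneq te => ->; rewrite mem_time_edges tau_pos.
Qed.

Lemma is_walk_rcons (V : finType) (G : tgraph V) v p x t :
  is_walk G v (rcons p (x, t)) =
  is_walk G v p && (t \in tau G [set last v (unzip1 p); x]).
Proof.
elim: p v => [|[y t'] p IHp] v /=; first by rewrite mem_time_edges andbT.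
by rewrite IHp andbA.
Qed.

Lemma path_last_ge t l : path ltn t l -> t <= last t l.
Proof.
elim: l t => [|t' l IHl] t //= /andP[tt' pl].
exact: leq_trans (ltnW tt') (IHl _ pl).
Qed.

(** The path is cut where it meets [v]; as times increase, the prefix ends no later than the whole
    path. *)
Lemma path_prefix (V : finType) (G : tgraph V) v p s t :
  is_walk G s p -> path ltn t (unzip2 p) -> uniq (s :: unzip1 p) ->
  v \in s :: unzip1 p ->
  exists q, [/\ is_walk G s q, path ltn t (unzip2 q), last s (unzip1 q) = v,
    uniq (s :: unzip1 q) /\ {subset unzip1 q <= unzip1 p}
    & last t (unzip2 q) <= last t (unzip2 p)].
Proof.
elim: p s t => [|[x t'] p IHp] s t.
  by move=> _ _ _; rewrite inE => /eqP->; exists [::].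
move=> w_p p_p u_p; rewrite inE => /predU1P[->|vp].
  by exists [::]; split=> //; apply: path_last_ge p_p.
move: w_p p_p u_p => /= /andP[te wp] /andP[tt' pp] /andP[sxp uxp].
have [q [wq pq lq [uq sq] leq]] := IHp x t' wp pp uxp vp.
exists ((x, t') :: q); split=> //=; first by rewrite te.
- by rewrite tt'.
- split; last by move=> y; rewrite !inE => /predU1P[->|/sq->]; rewrite ?eqxx ?orbT.
  rewrite -/(uniq (x :: unzip1 q)) uq andbT.
  by apply: contraNN sxp; rewrite !inE => /predU1P[->|/sq->]; rewrite ?eqxx ?orbT.
Qed.

Section Instance.
Variables (n : nat) (G : tgraph 'I_n) (S : {set 'I_n}).
Variables (ss0 : seq 'I_n) (ts0 : seq ('I_n * 'I_n * nat)).
Hypothesis ss0E : perm_eq ss0 (enum S).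
Hypothesis ts0E :
  perm_eq [seq ([set x.1.1; x.1.2]%SET, x.2) | x <- ts0] (time_edges G).

Let natx (x : 'I_n * 'I_n * nat) : nat * nat * nat := (val x.1.1, val x.1.2, x.2).
Let ss := [seq val v | v <- ss0].
Let ts := [seq natx x | x <- ts0].

Lemma ts0_uniq : uniq ts0.
Proof. by have := time_edges_uniq G; rewrite -(perm_uniq ts0E); apply: map_uniq. Qed.

Lemma mem_ts0 x : x \in ts0 -> x.2 \in tau G [set x.1.1; x.1.2].
Proof.
move=> xts; rewrite -mem_time_edges -(perm_mem ts0E).
exact: (map_f (fun x => ([set x.1.1; x.1.2]%SET, x.2))).
Qed.

Lemma tau_ts0 e t : t \in tau G e ->
  exists x, [/\ x \in ts0, e = [set x.1.1; x.1.2]%SET & x.2 = t].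
Proof.
rewrite -mem_time_edges -(perm_mem ts0E) => /mapP[x xts [-> ->]].
by exists x.
Qed.

Lemma mem_ss v : (val v \in ss) = (v \in S).
Proof. by rewrite mem_map ?(perm_mem ss0E) ?mem_enum //; apply: val_inj. Qed.

Lemma ss_uniq : uniq ss.
Proof. by rewrite map_inj_uniq ?(perm_uniq ss0E) ?enum_uniq //; apply: val_inj. Qed.

Lemma natx_pos x : x \in ts -> 0 < x.2.
Proof.
case/mapP=> y yts -> /=; rewrite lt0n.
by apply: contraTneq (mem_ts0 yts) => ->; apply: tau_pos.
Qed.

Lemma max_time_le : max_time ts <= lifetime G.
Proof.
apply/bigmax_leqP_seq => x /mapP[y yts ->] _ /=.
exact: lifetime_ge (mem_ts0 yts).
Qed.

Lemma le_max_time e t : t \in tau G e -> t <= max_time ts.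
Proof.
move=> /tau_ts0[x [xts _ <-]].
exact: (leq_bigmax_seq (natx x) (F := snd) (map_f natx xts)).
Qed.

Lemma tau_oriented u v t : t \in tau G [set u; v]%SET ->
  exists x, [/\ x \in ts0, [set u; v]%SET = [set x.1.1; x.1.2]%SET, x.2 = t
    & x.1 = (u, v) \/ x.1 = (v, u)].
Proof.
case/tau_ts0=> y [yts eq_uv yt]; exists y; split=> //.
have c2 : #|[set u; v]| = 2.
  apply: (@edges_card2 _ G); apply: contraTT (mem_ts0 yts) => nG.
  by rewrite -eq_uv (tau_edges nG) in_fset0.
have uv : u != v by apply: contra_eq_neq c2 => ->; rewrite setUid cards1.
have := set22 u v; have := set21 u v; rewrite eq_uv !inE.
rewrite [y.1]surjective_pairing => /orP[]/eqP uE /orP[]/eqP vE.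
- by rewrite uE vE eqxx in uv.
- by rewrite uE vE; left.
- by rewrite uE vE; right.
- by rewrite uE vE eqxx in uv.
Qed.

Lemma mem_ends x u : x \in ts -> u \in ends x ->
  exists v w : 'I_n, u = val v /\ x.2 \in tau G [set w; v]%SET.
Proof.
case/mapP=> y yts ->; rewrite !inE => /orP[]/eqP-> /=.
  by exists y.1.1, y.1.2; rewrite setUC; split=> //; apply: mem_ts0.
by exists y.1.2, y.1.1; split=> //; apply: mem_ts0.
Qed.

Lemma width_le t B : active ts t B -> size B <= vimw G.
Proof.
move=> [UB BE]; apply: leq_trans (vim_set_le G t).
rewrite cardE -(size_map val); apply: uniq_leq_size => // u.
rewrite BE => /andP[/hasP[x xts /andP[xt ux]] tu].
have [t0|t_gt0] := posnP t.
  by rewrite t0 leqNgt natx_pos in xt.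
have [y yts [uy ty]] : exists2 y, y \in ts & u \in ends y /\ t <= y.2.
  apply: contraTP tu => nex; rewrite -ltnNge -(prednK t_gt0) ltnS.
  apply/bigmax_leqP_seq => y yts uy; rewrite -ltnS (prednK t_gt0) ltnNge.
  by apply/negP => ty; apply: nex; exists y.
have [v [w [uE xv]]] := mem_ends xts ux; have [v' [w' [uE' yv]]] := mem_ends yts uy.
have vv' : v' = v by apply: val_inj; rewrite -uE.
rewrite vv' in yv; rewrite uE map_f // mem_enum inE; apply/asboolP.
by exists x.2, y.2, w, w'.
Qed.

Lemma end_vim x : x \in ts0 -> x.1.1 \in vim_set G x.2 /\ x.1.2 \in vim_set G x.2.
Proof.
move=> xts; have xt := mem_ts0 xts.
split; rewrite inE; apply/asboolP; exists x.2, x.2.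
  by exists x.1.2, x.1.2; rewrite setUC.
by exists x.1.1, x.1.1.
Qed.

(** A time-edge at [t] is listed once and is determined by its ordered pair of endpoints, both of
    which lie in [F_t]. *)
Lemma same_time_le t : count (fun x => x.2 == t) ts <= vimw G ^ 2.
Proof.
apply: (@leq_trans (#|vim_set G t| * #|vim_set G t|)); last first.
  by rewrite mulnn leq_sqr vim_set_le.
rewrite count_map -size_filter -cardsX cardE -(size_map (fun x => x.1)).
apply: uniq_leq_size.
  rewrite map_inj_in_uniq ?filter_uniq ?ts0_uniq // => x y.
  rewrite !mem_filter /= => /andP[/eqP xt _] /andP[/eqP yt _].
  by case: x y xt yt => [x1 x2] [y1 y2] /= -> -> ->.
move=> p /mapP[x]; rewrite mem_filter /= => /andP[/eqP <- xts] ->.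
by have [x1 x2] := end_vim xts; case: x.1 x1 x2 => a b; rewrite mem_enum !inE => ->.
Qed.

Lemma size_ts_le : size ts <= vimw G ^ 2 * lifetime G.
Proof.
have -> : size ts = \sum_(1 <= t < (lifetime G).+1) count (fun x => x.2 == t) ts.
  rewrite -sum1_size; under [RHS]eq_bigr do rewrite -sum1_count big_mkcond.
  rewrite exchange_big /=; apply: eq_big_seq => x xts.
  rewrite -big_mkcond sum1_count (eq_count (a2 := pred1 x.2)) //.
  rewrite count_uniq_mem ?iota_uniq //.
  rewrite mem_index_iota natx_pos //= ltnS.
  by rewrite (leq_trans _ max_time_le) //; apply: (leq_bigmax_seq (F := snd)).
apply: (@leq_trans (\sum_(1 <= t < (lifetime G).+1) vimw G ^ 2)).
  by apply: leq_sum => t _; apply: same_time_le.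
by rewrite sum_nat_const_nat subn1 mulnC.
Qed.

(** Both endpoints of a time-edge at [t] lie in [F_t]. This is what the comparison of [3 ^ w] with
    [2 ^ (w ^ 2)] rests on, as it fails for [w = 1]. *)
Lemma vimw_ge2 : 0 < size ts -> 2 <= vimw G.
Proof.
rewrite size_map; case E: ts0 => [//|x l] _.
have xts : x \in ts0 by rewrite E mem_head.
have <- : #|[set x.1.1; x.1.2]| = 2.
  apply: (@edges_card2 _ G); apply: contraTT (mem_ts0 xts) => nG.
  by rewrite (tau_edges nG) in_fset0.
apply: leq_trans (vim_set_le G x.2); apply: subset_leq_card.
have [x1 x2] := end_vim xts.
by apply/subsetP => v; rewrite in_set2 => /orP[]/eqP->.
Qed.

Definition cut (f : nat -> nat) (x : 'I_n * 'I_n * nat) : bool :=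
  0 < viol (phase x.2 f) (natx x).

Lemma deletionsE f : deletions ts (max_time ts) f = count (cut f) ts0.
Proof.
rewrite /deletions big_map -sum1_count big_mkcond [RHS]big_mkcond.
apply: eq_big_seq => x xts; rewrite (le_max_time (mem_ts0 xts)) /cut.
rewrite /viol /phase /=; set a := f _; set b := f _.
by case: (ltngtP a x.2) => _; case: (ltngtP b x.2).
Qed.

(** Induction along the walk: each step leaves a vertex after its infection time, and since a
    surviving time-edge is not cut, the next vertex is infected no later than the time of the
    step. *)
Lemma walk_bound D f p v t :
  (forall x, x \in ts0 -> cut f x -> ([set x.1.1; x.1.2]%SET, x.2) \in D) ->
  f (val v) <= t -> is_walk (delete G D) v p -> path ltn t (unzip2 p) ->
  f (val (last v (unzip1 p))) <= last t (unzip2 p).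
Proof.
move=> cutD; elim: p v t => [|[x t'] p IHp] v t //= fv /andP[te wp] /andP[tt' pp].
apply: IHp => //.
move: te; rewrite mem_time_edges !inE /= => /andP[te nD].
have [y [yts eq_y yt yE]] := tau_oriented te; rewrite eq_y -yt in nD.
have := contraNN (cutD y yts) nD; rewrite /cut /viol /phase /= yt.
by case: yE => ->; rewrite /= -?leqNgt; lia.
Qed.

Lemma spread_MinReachDelete k h f : spread ss ts f ->
  infected ss ts (max_time ts) f <= h -> deletions ts (max_time ts) f <= k ->
  MinReachDelete G S k h.
Proof.
move=> sf fh fk.
pose D0 := [seq ([set x.1.1; x.1.2]%SET, x.2) | x <- ts0 & cut f x].
exists [fset y in D0]%fset; split.
- move=> y; rewrite !inE => /mapP[x]; rewrite mem_filter => /andP[_ xts] ->.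
  by rewrite mem_time_edges mem_ts0.
- apply: leq_trans fk; rewrite card_fseq (leq_trans (size_undup _)) //.
  by rewrite size_map size_filter deletionsE.
- apply: leq_trans fh; rewrite cardE -(size_map val) /infected -size_filter -size_cat.
  apply: uniq_leq_size => [|u /mapP[v]].
    by rewrite map_inj_uniq ?enum_uniq //; apply: val_inj.
  rewrite mem_enum inE => /asboolP[v0 v0S [p /andP[/and3P[wp sp /eqP lp] _]]] ->.
  rewrite mem_cat mem_filter mem_ss; case: (boolP (v \in S)) => //= vS.
  have fle : f (val v) <= max_time ts.
    have pos_path := walk_path0 wp sp.
    rewrite -lp.
    apply: leq_trans (@walk_bound [fset y in D0]%fset f p v0 0 _ _ wp pos_path) _.
    + move=> x xts cx; rewrite inE; apply/mapP.
      by exists x => //; rewrite mem_filter cx.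
    + by rewrite sf.1 // mem_ss.
    + elim: p (v0) wp {sp lp pos_path} 0 (leq0n (max_time ts)) => [|[x t] p IHp] v1 //=.
      move=> /andP[te wp] t0 _.
      apply: IHp wp _ _; move: te; rewrite mem_time_edges !inE => /andP[te _].
      exact: le_max_time te.
  have vss : val v \notin ss by rewrite mem_ss.
  have [_ [//|sv _]] := sf.2 _ vss.
  by rewrite fle (seen_verts sv).
Qed.

Definition arrives (D : {fset {set 'I_n} * nat}) (t : nat) (v : 'I_n) : Prop :=
  exists s p, [/\ s \in S, temporal_path (delete G D) s v p & last 0 (unzip2 p) <= t].

(** Earliest arrival time; when no time up to [max_time ts] succeeds, [find] returns the length
    [(max_time ts).+1], which stands for never. *)
Definition arrival D v : nat :=
  find (fun t => `[< arrives D t v >]) (iota 0 (max_time ts).+1).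

Lemma arrives_le D t t' v : t <= t' -> arrives D t v -> arrives D t' v.
Proof.
by move=> tt' [s [p [sS tp le]]]; exists s, p; split=> //; apply: leq_trans tt'.
Qed.

Lemma arrival_leP D v t : t <= max_time ts -> arrival D v <= t <-> arrives D t v.
Proof.
move=> t_max; split=> [le_t|ar].
  have lt_max : arrival D v < (max_time ts).+1 by apply: leq_trans t_max.
  have : has (fun t => `[< arrives D t v >]) (iota 0 (max_time ts).+1).
    by rewrite has_find size_iota.
  move/(nth_find 0); rewrite nth_iota // add0n => /asboolP.
  exact: arrives_le.
rewrite leqNgt; apply/negP => lt_t.
have := before_find 0 lt_t; rewrite nth_iota ?ltnS // add0n => /asboolP.
by [].
Qed.

Lemma arrives_source D v : v \in S -> arrives D 0 v.
Proof. by move=> vS; exists v, [::]; rewrite /temporal_path /temporal_walk /= eqxx. Qed.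

(** If the path already visits [v], appending the time-edge would repeat a vertex, so the prefix
    ending at [v] is used instead. *)
Lemma arrives_step D t' t u v : arrives D t' u -> t' < t ->
  t \in tau (delete G D) [set u; v] -> arrives D t v.
Proof.
move=> [s [p [sS /andP[/and3P[wp sp /eqP lp] up] le]]] tt' te.
have pp := walk_path0 wp sp.
case: (boolP (v \in s :: unzip1 p)) => vp.
  have [q [wq pq lq [uq _] le_q]] := path_prefix wp pp up vp.
  exists s, q; split=> //; last exact: leq_trans le_q (leq_trans le (ltnW tt')).
  by rewrite /temporal_path /temporal_walk wq lq eqxx uq (path_sorted pq).
exists s, (rcons p (v, t)); split=> //; last by rewrite /unzip2 map_rcons last_rcons.
rewrite /temporal_path /temporal_walk is_walk_rcons wp lp te /unzip1 /unzip2 !map_rcons.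
rewrite last_rcons eqxx /= andbT; apply/andP; split.
  by apply: (@path_sorted _ _ 0); rewrite rcons_path pp; apply: leq_ltn_trans tt'.
move: vp up; rewrite inE negb_or /= => /andP[vs vp] /andP[sp1 up1].
by rewrite rcons_uniq mem_rcons inE negb_or eq_sym vs sp1 vp up1.
Qed.

Lemma arrives_last D t v : arrives D t v -> v \in S \/
  exists w t', [/\ 0 < t', t' <= t, t' \in tau G [set w; v] & arrives D t' v].
Proof.
case=> s [p [sS tp le]]; have /andP[/and3P[wp sp lp] _] := tp.
case/lastP: p wp sp lp tp le => [|p [x t']] wp sp.
  by move=> /eqP /= <- _ _; left.
rewrite {1}/unzip1 map_rcons last_rcons => /eqP /= xv tp.
rewrite /unzip2 map_rcons last_rcons => le; right.
move: wp; rewrite is_walk_rcons xv => /andP[_].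
set u := last _ _; rewrite !inE => /andP[te _].
exists u, t'; split=> //.
  by rewrite lt0n; apply: contraTneq te => ->; apply: tau_pos.
by exists s, (rcons p (x, t')); rewrite /unzip2 map_rcons last_rcons.
Qed.

Lemma MinReachDelete_spread k h : MinReachDelete G S k h ->
  exists f, [/\ spread ss ts f, infected ss ts (max_time ts) f <= h
    & deletions ts (max_time ts) f <= k].
Proof.
case=> D [sD Dk Dh].
pose f u := if insub u is Some v then arrival D v else (max_time ts).+1.
have fE (v : 'I_n) : f (val v) = arrival D v by rewrite /f valK.
have f_le u t : t <= max_time ts -> f u <= t -> exists2 v, u = val v & arrives D t v.
  move=> t_max; rewrite /f; case: insubP => [v _ <-|_] fu; last by lia.
  by exists v => //; apply/arrival_leP.
exists f; split.
- split=> u.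
    move=> uss; have /mapP[v vss uE] := uss; rewrite uE mem_ss in uss *.
    by apply/eqP; rewrite -leqn0 fE; apply/arrival_leP => //; apply: arrives_source.
  move=> uss; split.
    rewrite lt0n -leqn0; apply/negP => /(f_le _ _ (leq0n _))[v uE].
    rewrite uE mem_ss in uss; case/arrives_last; first by apply/negP.
    by case=> w [t' [t'0]]; rewrite leqNgt t'0.
  move=> fu; have [v uE ar] := f_le u (f u) fu (leqnn _).
  rewrite uE mem_ss in uss; case/arrives_last: ar; first by move/(negP uss).
  case=> w [t' [t'0 t'f te ar]].
  (* An arrival at [t' <= f u] cannot precede the earliest one, so some time-edge at [v] has time
     exactly [f u], as [spread] demands. *)
  have {t'f} t'E : t' = f u.
    apply/eqP; rewrite eqn_leq t'f uE fE; apply/arrival_leP => //.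
    exact: le_max_time te.
  have [x [xts _ xt xE]] := tau_oriented te.
  have ux : val v \in ends (natx x).
    by case: xE => xE; rewrite /natx xE !inE eqxx ?orbT.
  have xts' : natx x \in ts by apply: map_f.
  by rewrite -t'E -xt uE; split; [apply: seen_end ux | apply: last_end ux].
- apply: leq_trans Dh; rewrite cardE -(size_map val) /infected -size_filter -size_cat.
  apply: uniq_leq_size => [|u].
    rewrite cat_uniq ss_uniq filter_uniq ?undup_uniq // andbT.
    by apply/hasPn => u; rewrite mem_filter => /andP[/andP[]].
  have reachP (v : 'I_n) t : arrives D t v ->
      val v \in [seq val i | i <- enum (reach (delete G D) S)].
    move=> [s [p [sS tp _]]]; rewrite map_f // mem_enum inE; apply/asboolP.
    by exists s => //; exists p.
  rewrite mem_cat mem_filter => /orP[uss|/andP[/andP[_ fu] _]].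
    have /mapP[v vss uE] := uss; rewrite uE mem_ss in uss *.
    exact: reachP (arrives_source D uss).
  by have [v -> ar] := f_le u _ (leqnn _) fu; apply: reachP ar.
- apply: leq_trans Dk; rewrite deletionsE -size_filter.
  rewrite -(size_map (fun x => ([set x.1.1; x.1.2]%SET, x.2))).
  apply: uniq_leq_size => [|y /mapP[x]].
    have := time_edges_uniq G; rewrite -(perm_uniq ts0E); apply: subseq_uniq.
    exact/map_subseq/filter_subseq.
  rewrite mem_filter => /andP[cx xts] ->; apply: contraTT cx => nD.
  have te := mem_ts0 xts.
  have te' : x.2 \in tau (delete G D) [set x.1.1; x.1.2] by rewrite !inE /= te.
  have x_pos : 0 < x.2 by apply: (natx_pos (map_f natx xts)).
  have x_max := le_max_time te.
  (* A time-edge that survives transmits in both directions, which is impossible for one that [f]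
     cuts; hence all cut time-edges are in [D]. *)
  have infect (u v : 'I_n) : x.2 \in tau (delete G D) [set u; v] ->
      f (val u) < x.2 -> f (val v) <= x.2.
    move=> tuv fu; rewrite fE; apply/arrival_leP => //.
    have pred_max : x.2.-1 <= max_time ts by apply: leq_trans (leq_pred _) x_max.
    have [|u' /val_inj uE ar] := f_le (val u) x.2.-1 pred_max.
      by rewrite -ltnS prednK.
    by apply: arrives_step ar _ _; rewrite -?uE // prednK.
  have := infect _ _ te'; rewrite setUC in te'; have := infect _ _ te'.
  rewrite /cut /viol /phase /=; set a := f _; set b := f _.
  by case: (ltngtP a x.2); case: (ltngtP b x.2) => // _ _ H1 H2;
    first [by have := H1 isT | by have := H2 isT].
Qed.

End Instance.

(** * The time bound and the final assembly *)

Lemma body_time_le w h L m M : 2 <= w -> 0 < h -> 0 < L -> M <= L ->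
  m <= w ^ 2 * L ->
  100 * (m + h + 2) + M * (3 ^ w * (400 * (w + w ^ 2 + h + 4)) + 10) + 50 * h.+2
    <= 2100 * (w ^ 2 * h * 2 ^ (w ^ 2) * L).
Proof.
move=> w2 h0 L0 ML mL.
have w_sq : w * 2 <= w ^ 2 by rewrite -mulnn leq_mul2l w2 orbT.
have pow_le : 3 ^ w <= 2 ^ (w ^ 2).
  apply: (@leq_trans (4 ^ w)); first by rewrite leq_exp2r //; lia.
  by rewrite -[4]/(2 ^ 2) -expnM leq_pexp2l // mulnC.
have P0 : 0 < 2 ^ (w ^ 2) by rewrite expn_gt0.
move: (2 ^ _) pow_le P0 => P pow_le P0; move: (3 ^ w) pow_le => p3 pow_le.
move: (w ^ 2) w_sq mL => q w_sq mL.
set Y := q * h * P * L.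
have qhY : q * h <= Y by rewrite /Y -mulnA leq_pmulr // muln_gt0 P0.
have q_h : q <= q * h by rewrite leq_pmulr.
have h_q : h <= q * h by rewrite leq_pmull //; lia.
have mY : m <= Y.
  apply: leq_trans mL _; rewrite /Y leq_mul2r -mulnA leq_pmulr ?orbT //.
  by rewrite muln_gt0 h0.
have LY : L <= Y by rewrite /Y leq_pmull // !muln_gt0 h0 P0; lia.
(* The factor [1600] is [400 * 4], from [w + q + h + 4 <= 4 * (q * h)]; the overhead of [10] per
   time step adds at most [10 * Y] as [L <= Y]. *)
have stepY : M * (p3 * (400 * (w + q + h + 4)) + 10) <= 1610 * Y.
  apply: (@leq_trans (L * (P * (400 * (4 * (q * h))) + 10))).
    by apply: leq_mul => //; rewrite leq_add2r leq_mul // leq_mul2l /=; lia.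
  rewrite mulnDr (_ : L * (P * _) = 1600 * Y); last by rewrite /Y; lia.
  by lia.
by lia.
Qed.

Theorem theorem6p4 :
  exists (c : cmd) (C : nat),
    forall (n : nat) (G : tgraph 'I_n) (S : {set 'I_n}) (k h : nat) (s : state),
      encodes G S k h s ->
      exists (T : nat) (s' : state),
        [/\ exec c s T s',
            accepts s' <-> MinReachDelete G S k h
          & T <= C * (vimw G ^ 2 * h * 2 ^ (vimw G ^ 2) * lifetime G + 1)].
Proof.
(* When [h] or the lifetime is [0], so is the product; then only the guards and a constant answer
   are executed, paid for by the summand [1]. *)
exists program, 3000 => n G S k h _ [ss0 [es [ts0 [ss0E _ ts0E ->]]]].
set s := input_state k h ss0 es ts0; set X := _ * lifetime G.
pose ss := [seq val v | v <- ss0].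
pose natx (x : 'I_n * 'I_n * nat) := (val x.1.1, val x.1.2, x.2).
pose ts := [seq natx x | x <- ts0].
pose good := exists f, [/\ spread ss ts f, infected ss ts (max_time ts) f <= h
  & deletions ts (max_time ts) f <= k].
have goodP : good <-> MinReachDelete G S k h.
  split=> [[f [sf fh fk]]|]; first exact: spread_MinReachDelete sf fh fk.
  exact: MinReachDelete_spread.
suff [T [s' [ex Tle ac]]] :
    run program s (2100 * X + 100) (fun s' => accepts s' <-> good).
  by exists T, s'; split=> //; [rewrite ac | lia].
have szs : size ss = size ss0 by rewrite size_map.
have szt : size ts = size ts0 by rewrite size_map.
have accept_true Q : Q -> run (Assign 0 (Cst 1)) s 2 (fun s' => accepts s' <-> Q).
  by move=> q; apply: run_straight.
eapply run_weaken with (Q := fun s' => accepts s' <-> good); last by [].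
  apply: run_if => [gt_h|le_h].
    apply: run_straight => //; split=> // -[f [_ fh _]].
    by move: gt_h; rewrite /= subn_eq0 -szs (leq_trans (leq_addr _ _) fh).
  have {}le_h : size ss <= h by move/eqP: le_h; rewrite /= subn_eq0 szs.
  eapply run_if => [ss_gt0|ss0_nil].
    eapply run_if with (t1 := 2100 * X) => [ts_gt0|ts_nil].
      have {}ts_gt0 : 0 < size ts by rewrite szt lt0n.
      have nthE (g : 'I_n * 'I_n * nat -> nat) g' : g' (0, 0, 0) = 0 ->
          (forall x, g x = g' (natx x)) ->
          nth 0 [seq g x | x <- ts0] = (fun i => g' (nth (0, 0, 0) ts i)).
        move=> g0 gE; apply: functional_extensionality.
        rewrite /ts; elim: (ts0) => [|x l IHl] [|i] //=; rewrite ?g0 //.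
      have max0 : 0 < lifetime G.
        apply: leq_trans (max_time_le ts0E).
        have /hasP[x xts _] : has predT ts by rewrite has_predT.
        apply: leq_trans (natx_pos ts0E xts) _.
        exact: (leq_bigmax_seq (F := snd)).
      eapply run_weaken.
      - apply: (@run_body k h ss ts (natx_pos ts0E) le_h (vimw G) (vimw G ^ 2)) => //.
        + by move=> t B; apply: width_le.
        + by move=> t; rewrite size_bucket // take_size same_time_le.
        + by move=> x x5; rewrite /= nth_default.
        + exact: (nthE _ (fun x => x.1.1)).
        + exact: (nthE _ (fun x => x.1.2)).
        + exact: (nthE _ (fun x => x.2)).
        + move=> a a5; apply: functional_extensionality => i.
          by rewrite /= [nth [::] _ a]nth_default ?nth_nil.
      - apply: body_time_le => //.
        + exact: vimw_ge2 ts_gt0.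
        + by apply: leq_trans le_h; rewrite szs lt0n.
        + exact: max_time_le.
        + exact: size_ts_le.
      - by [].
    apply: accept_true; have ts0_nil : ts = [::] by apply: size0nil; rewrite szt.
    (* Without time-edges [max_time] is [0], so the value [1] already means never. *)
    exists (fun u => u \notin ss : nat); rewrite /deletions ts0_nil big_nil.
    rewrite /infected addn0; split=> //; split=> u; first by move=> ->.
    by move=> uss; rewrite uss /max_time big_nil.
  apply: accept_true; have ss_nil : ss = [::] by apply: size0nil; rewrite szs.
  exists (fun=> (max_time ts).+1); rewrite ss_nil; split.
  - by split=> // u _; rewrite ltnn.
  - by rewrite /infected (@eq_count _ _ pred0) ?count_pred0 // => u; rewrite ltnn.
  - rewrite /deletions big1_seq // => x _; rewrite /viol /phase.
    by case: (_ < _); case: (_ <= _).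
by rewrite /=; lia.
Qed.
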